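(* Let $(R, \mathfrak{m})$ be an equidimensional Noetherian local ring of dimension $d$ and of prime characteristic $p$ that is a homomorphic image of a Cohen-Macaulay local ring. Let $x_1, \ldots, x_d$ be a system of parameters of $R$, and put $Q_s = (x_1, \ldots, x_s)$. Then for all $1 \le s \le d$ and all $n \ge 1$ we have $$\bigcap_{\alpha \in \Lambda_{s,n}} Q_s(\alpha)^{*} = (Q_s^n)^{*},$$ where $I^{*}$ denotes the tight closure of an ideal $I$.
   Context: For $s, n \ge 1$, $$\Lambda_{s,n} = \{(\alpha_1, \ldots, \alpha_s) \in \mathbb{N}^s \mid \alpha_i \ge 1 \text{ for all } 1 \le i \le s,\ \sum_{i=1}^s \alpha_i = s+n-1\},$$ and for $\alpha \in \Lambda_{s,n}$, $Q_s(\alpha) = (x_1^{\alpha_1}, \ldots, x_s^{\alpha_s})$. An element $x \in R$ lies in the tight closure $I^{*}$ of an ideal $I$ if there is some $c \in R$ with $c \notin P$ for all minimal primes $P$ of $R$ such that $c x^{p^e} \in I^{[p^e]}$ for all $e \gg 0$, where $I^{[p^e]} = (a^{p^e} \mid a \in I)$ is the $e$-th Frobenius power of $I$. Equidimensional means $\dim R/P = \dim R$ for every minimal prime $P$ of $R$. *)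

(* Defs.v *)
From HB Require Import structures.
From mathcomp Require Import all_boot all_order all_algebra.
From mathcomp Require Import all_classical.

Set Implicit Arguments.
Unset Strict Implicit.
Unset Printing Implicit Defensive.

Import Order.TTheory GRing.Theory.

Local Open Scope classical_set_scope.
Local Open Scope ring_scope.

(* Arbitrary (possibly improper) ideals are sets [I : set R] satisfying       *)
(* [is_ideal].  Proper and prime ideals are elements of the bundled types     *)
(* [idealr R] and [prime_idealr R] of ring_quotient, which are                *)
(* boolean predicates; since every proposition is classically reflected by a  *)
(* boolean, these types contain all proper, respectively prime, ideals.       *)

Section Ideals.
Variable R : comNzRingType.
Implicit Types (I J A : set R).

Definition is_ideal I : Prop :=
  [/\ I 0, (forall a b, I a -> I b -> I (a + b))
         & (forall r a, I a -> I (r * a))].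

Definition ideal_gen A : set R := smallest is_ideal A.

Definition ideal_mul I J : set R :=
  ideal_gen [set a * b | a in I & b in J].

Fixpoint ideal_pow I (n : nat) : set R :=
  if n is n'.+1 then ideal_mul I (ideal_pow I n') else setT.

Definition radical I : set R := [set a | exists n : nat, I (a ^+ n)].

(* For [q = p ^ e] with [p] the characteristic, the Frobenius power I^[q].    *)
Definition frobenius_power I (q : nat) : set R :=
  ideal_gen [set a ^+ q | a in I].

Definition minimal_prime (P : prime_idealr R) : Prop :=
  forall P' : prime_idealr R, {subset P' <= P} -> {subset P <= P'}.

Definition tight_closure (p : nat) I : set R :=
  [set x | exists2 c : R,
     (forall P : prime_idealr R, minimal_prime P -> c \notin P) &
     exists e0 : nat, forall e : nat, (e0 <= e)%N ->
       frobenius_power I (p ^ e) (c * x ^+ (p ^ e))].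

End Ideals.

Section Rings.
Variable R : comNzRingType.

Definition noetherian : Prop :=
  forall I : set R, is_ideal I -> exists s : seq R, I = ideal_gen [set` s].

Definition maximal_ideal (m : idealr R) : Prop :=
  forall I : idealr R, {subset m <= I} -> {subset I <= m}.

Definition local_ring (m : idealr R) : Prop :=
  maximal_ideal m /\ (forall m' : idealr R, maximal_ideal m' -> m' =i m).

(* Strictly increasing chains P_0 < P_1 < ... < P_k, of length k.             *)
Definition prime_chain (k : nat) (P : 'I_k.+1 -> prime_idealr R) : Prop :=
  forall i j : 'I_k.+1, (i < j)%N ->
    {subset P i <= P j} /\ ~ {subset P j <= P i}.

(* A relation rather than a function, as the dimension may be infinite.       *)
Definition has_krull_dim (d : nat) : Prop :=
  (exists P : 'I_d.+1 -> prime_idealr R, prime_chain P) /\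
  (forall (k : nat) (P : 'I_k.+1 -> prime_idealr R),
     prime_chain P -> (k <= d)%N).

(* The condition that the sequence generates a proper ideal is implied by     *)
(* its terms lying in [m].                                                    *)
Definition regular_sequence (m : idealr R) (xs : seq R) : Prop :=
  (forall a, a \in xs -> a \in m) /\
  (forall (i : nat) (y : R), (i < size xs)%N ->
     ideal_gen [set` take i xs] (xs`_i * y) -> ideal_gen [set` take i xs] y).

Definition has_depth (m : idealr R) (k : nat) : Prop :=
  (exists2 xs : seq R, regular_sequence m xs & size xs = k) /\
  (forall xs : seq R, regular_sequence m xs -> (size xs <= k)%N).

Definition cohen_macaulay_local : Prop :=
  noetherian /\
  exists m : idealr R, local_ring m /\
  exists2 d : nat, has_krull_dim d & has_depth m d.

(* To be used when [d] is the dimension of [R]: the ideal generated by the    *)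
(* [d] elements is primary to the maximal ideal.                              *)
Definition system_of_parameters (m : idealr R) (d : nat) (x : 'I_d -> R) :
    Prop :=
  radical (ideal_gen (range x)) = [set` m].

End Rings.

Arguments noetherian R : clear implicits.
Arguments has_krull_dim R d : clear implicits.
Arguments cohen_macaulay_local R : clear implicits.

Definition equidimensional (R : comNzRingType) : Prop :=
  forall P : prime_idealr R, minimal_prime P ->
    forall k : nat, has_krull_dim {ideal_quot P} k <-> has_krull_dim R k.

Definition image_of_cohen_macaulay_local (R : comNzRingType) : Prop :=
  exists S : comNzRingType, cohen_macaulay_local S /\
  exists f : {rmorphism S -> R}, range f = setT.

Definition Lambda (s n : nat) : set ('I_s -> nat) :=
  [set alpha | (forall i, (1 <= alpha i)%N) /\
               (\sum_(i < s) alpha i = s + n - 1)%N].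
Arguments Lambda s n : clear implicits.

(* The first [s] terms of a family of length [d].                             *)
Definition initial (R : Type) (s d : nat) (le_sd : (s <= d)%N)
    (x : 'I_d -> R) : 'I_s -> R :=
  fun i => x (widen_ord le_sd i).

Definition power_ideal (R : comNzRingType) (s : nat) (x : 'I_s -> R)
    (alpha : 'I_s -> nat) : set R :=
  ideal_gen (range (fun i : 'I_s => x i ^+ alpha i)).

(* Main.v *)
(* In a Cohen-Macaulay ring the intersection of the ideals Q_s(alpha) is Q_s^n:
   modulo x_s one argues by induction on s, and the remainder is divisible by
   x_s, which leads to a smaller n.  The only property of the x_i used here is
   that of colon ideals of the form (x_i^{a_i} : i <> j) : x_j^b, and a constant
   c multiplying these into (x_i^{a_i} : i <> j) makes the argument work up to a
   power of c that depends on s and n alone.  Applied to the Frobenius powers,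
   with c outside all minimal primes, this gives the statement.

   To find c, write R = S / I with S Cohen-Macaulay.  Choose an ideal J of I
   generated by a maximal S-regular sequence in I; lifts of the x_i can be
   chosen to be regular on S / J, so that the Koszul homology of their powers
   on S / J vanishes in positive degrees.  By equidimensionality every minimal
   prime P of I is minimal over J, hence S / P embeds in S / J.  Descending
   induction on i, with a prime filtration, shows that the i-th Koszul homology
   of the powers of the x_i on S / K, for any ideal K containing J, is killed by
   an element outside P that does not depend on the exponents.  The case K = I,
   i = 1 is what is needed.  No element has to be raised to a p-th power in S,
   whose characteristic is arbitrary. *)
Require Import Defs.
From HB Require Import structures.
From mathcomp Require Import all_boot all_order all_algebra.
From mathcomp Require Import all_classical.
From mathcomp Require Import zify ring.

Set Implicit Arguments.
Unset Strict Implicit.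
Unset Printing Implicit Defensive.

Import Order.TTheory GRing.Theory.

Local Open Scope classical_set_scope.
Local Open Scope ring_scope.

(** * Ideals and chains of primes *)

Section IdealBasics.
Variable R : comNzRingType.
Implicit Types (I J K P Q : set R) (a b r t u : R).

Definition is_prime P : Prop :=
  [/\ is_ideal P, ~ P 1 & forall a b, P (a * b) -> P a \/ P b].

Definition colon J a : set R := [set t | J (t * a)].

Definition adjoin J a : set R := [set t | exists r, J (t - r * a)].

Lemma ideal_0 J : is_ideal J -> J 0. Proof. by case. Qed.

Lemma ideal_add J a b : is_ideal J -> J a -> J b -> J (a + b).
Proof. by case=> _ hD _; apply: hD. Qed.

Lemma ideal_mull J r a : is_ideal J -> J a -> J (r * a).
Proof. by case=> _ _ hM; apply: hM. Qed.

Lemma ideal_mulr J r a : is_ideal J -> J a -> J (a * r).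
Proof. by rewrite mulrC; apply: ideal_mull. Qed.

Lemma ideal_opp J a : is_ideal J -> J a -> J (- a).
Proof. by move=> iJ Ja; rewrite -mulN1r; apply: ideal_mull. Qed.

Lemma ideal_sub J a b : is_ideal J -> J a -> J b -> J (a - b).
Proof. by move=> iJ Ja Jb; apply: ideal_add => //; apply: ideal_opp. Qed.

Lemma ideal_subr J a b : is_ideal J -> J b -> J (a - b) -> J a.
Proof. by move=> iJ Jb Jab; rewrite -(subrK b a); apply: ideal_add. Qed.

Lemma ideal_gen_ideal (A : set R) : is_ideal (ideal_gen A).
Proof.
split=> [K [iK _]|a b ha hb K hK|r a ha K hK].
- exact: ideal_0.
- by apply: ideal_add; [case: hK|apply: ha|apply: hb].
- by apply: ideal_mull; [case: hK|apply: ha].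
Qed.

Lemma mem_ideal_gen (A : set R) a : A a -> ideal_gen A a.
Proof. exact: sub_gen_smallest. Qed.

Lemma ideal_gen_sub (A K : set R) :
  is_ideal K -> (forall a, A a -> K a) -> forall t, ideal_gen A t -> K t.
Proof. by move=> iK AK; apply: smallest_sub. Qed.

Lemma is_ideal_set0 : is_ideal [set 0 : R].
Proof.
by split=> [//|a b -> ->|r a ->] /=; rewrite ?addr0 ?mulr0.
Qed.

Lemma colon_ideal J a : is_ideal J -> is_ideal (colon J a).
Proof.
move=> iJ; split; rewrite /colon /=.
- by rewrite mul0r; apply: ideal_0.
- by move=> s t ? ?; rewrite mulrDl; apply: ideal_add.
- by move=> r s ?; rewrite -mulrA; apply: ideal_mull.
Qed.

Lemma sub_colon J a t : is_ideal J -> J t -> colon J a t.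
Proof. by move=> iJ Jt; apply: ideal_mulr. Qed.

Lemma adjoin_ideal J a : is_ideal J -> is_ideal (adjoin J a).
Proof.
move=> iJ; split; rewrite /adjoin /=.
- by exists 0; rewrite mul0r subr0; apply: ideal_0.
- move=> s t [r hr] [r' hr']; exists (r + r').
  by have := ideal_add iJ hr hr'; congr (J _); ring.
- move=> r s [r' hr']; exists (r * r').
  by have := ideal_mull r iJ hr'; congr (J _); ring.
Qed.

Lemma sub_adjoin J a t : J t -> adjoin J a t.
Proof. by exists 0; rewrite mul0r subr0. Qed.

Lemma mem_adjoin J a : is_ideal J -> adjoin J a a.
Proof. by exists 1; rewrite mul1r subrr; apply: ideal_0. Qed.

Lemma adjoin_sub J K a : is_ideal K -> (forall t, J t -> K t) -> K a ->
  forall t, adjoin J a t -> K t.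
Proof.
by move=> iK JK Ka t [r /JK]; apply: ideal_subr => //; apply: ideal_mull.
Qed.

Lemma prime_ideal P : is_prime P -> is_ideal P. Proof. by case. Qed.

Lemma prime_pow P a n : is_prime P -> P (a ^+ n) -> P a.
Proof.
move=> [_ P1 PM]; elim: n => [|n IH]; first by rewrite expr0.
by rewrite exprS => /PM[].
Qed.

Lemma prime_idealr_is_prime (P : prime_idealr R) : is_prime [set` P].
Proof.
split=> /=; last by move=> a b; rewrite prime_idealrM => /orP.
  split=> /=; first exact: idealr0.
    by move=> a b; apply: rpredD.
  by move=> r a; apply: idealMr.
by rewrite idealr1.
Qed.

Lemma idealr_is_ideal (P : idealr R) : is_ideal [set` P].
Proof.
split=> /=; first exact: idealr0.
  by move=> a b; apply: rpredD.
by move=> r a; apply: idealMr.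
Qed.

Section Bundle.
Variable P : set R.
Let S := fun a : R => `[< P a >].

Lemma idealr_of : is_ideal P -> ~ P 1 ->
  exists I : idealr R, forall a, (a \in I) = `[< P a >].
Proof.
move=> iP P1.
have hS : @idealr_closed R S.
  split; rewrite ?unfold_in.
  - by apply/asboolP; apply: ideal_0.
  - by apply/asboolP.
  - move=> a u v; rewrite !unfold_in => /asboolP Pu /asboolP Pv; apply/asboolP.
    by apply: ideal_add => //; apply: ideal_mull.
pose T := HB.pack_for (idealr R) S (isIdealr.Build R S hS).
by exists T.
Qed.

Lemma prime_idealr_of : is_prime P ->
  exists I : prime_idealr R, forall a, (a \in I) = `[< P a >].
Proof.
move=> [iP P1 PM].
have hS : @idealr_closed R S.
  split; rewrite ?unfold_in.
  - by apply/asboolP; apply: ideal_0.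
  - by apply/asboolP.
  - move=> a u v; rewrite !unfold_in => /asboolP Pu /asboolP Pv; apply/asboolP.
    by apply: ideal_add => //; apply: ideal_mull.
have hP : @prime_idealr_closed R S.
  move=> u v; rewrite !unfold_in => /asboolP /PM.
  by case=> h; apply/orP; [left|right]; apply/asboolP.
pose T := HB.pack_for (prime_idealr R) S (isIdealr.Build R S hS)
   (isPrimeIdealrClosed.Build R S hP).
by exists T.
Qed.

End Bundle.

(* [prime_chain] for primes given as sets, which makes it easy to concatenate *)
(* chains; the values [C i] for [k < i] are irrelevant.                       *)
Definition strict_chain (k : nat) (C : nat -> set R) : Prop :=
  (forall i, (i <= k)%N -> is_prime (C i)) /\
  (forall i, (i < k)%N ->
     (forall t, C i t -> C i.+1 t) /\ exists2 t, C i.+1 t & ~ C i t).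

Lemma strict_chain_rcons k C Q : strict_chain k C -> is_prime Q ->
  (forall t, C k t -> Q t) -> (exists2 t, Q t & ~ C k t) ->
  strict_chain k.+1 (fun i => if (i <= k)%N then C i else Q).
Proof.
move=> [Cp Cs] pQ CQ hQ; split=> i.
  by case: (leqP i k) => [/Cp|].
move=> lik1; have := lik1; rewrite ltnS => lik0 /=.
have [->|nik] := eqVneq i k.
  by rewrite leqnn ltnn.
have lik : (i < k)%N by rewrite ltn_neqAle nik.
by rewrite lik0 lik; apply: Cs.
Qed.

Lemma strict_chain_cat k l C C' : strict_chain k C -> strict_chain l C' ->
  C k = C' 0%N ->
  strict_chain (k + l) (fun i => if (i <= k)%N then C i else C' (i - k)%N).
Proof.
move=> [Cp Cs] [Cp' Cs'] e; split=> i.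
  case: (leqP i k) => [/Cp //|lki] lil; apply: Cp'.
  by rewrite leq_subLR.
move=> lil /=; case: (ltngtP i k) => [lik|lki|eik].
- exact: Cs.
- by rewrite subSn ?(ltnW lki) //; apply: Cs'; rewrite ltn_subLR // ltnW.
- have l0 : (0 < l)%N by move: lil; rewrite eik; lia.
  by rewrite eik e subSnn; apply: Cs'.
Qed.

Lemma strict_chain_mono k C : strict_chain k C ->
  forall i j, (i <= j)%N -> (j <= k)%N -> forall t, C i t -> C j t.
Proof.
move=> [_ Cs] i j; elim: j => [|j IH] lij ljk t; first by move: lij;
  rewrite leqn0 => /eqP->.
move: lij; rewrite leq_eqVlt => /orP[/eqP->//|lij] Ct.
by apply: (Cs j ljk).1; apply: IH => //; apply: ltnW.
Qed.

Lemma strict_chain_prime_chain k C : strict_chain k C ->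
  exists P : 'I_k.+1 -> prime_idealr R, prime_chain P.
Proof.
move=> Ck; have [Cp Cs] := Ck.
have h (i : 'I_k.+1) : exists I : prime_idealr R, forall a,
  (a \in I) = `[< C i a >].
  by apply: prime_idealr_of; apply: Cp; rewrite -ltnS.
have [P hP] := choice h.
exists P => i j lij.
have ljk : (j <= k)%N by rewrite -ltnS.
split=> [t|].
  by rewrite !hP => /asboolP Ct; apply/asboolP;
    apply: (strict_chain_mono Ck (ltnW lij)).
have [_ [t Ct nCt]] := Cs i (leq_trans lij ljk).
move=> /(_ t); rewrite !hP => h'; apply: nCt; apply/asboolP; apply: h'.
by apply/asboolP; apply: (strict_chain_mono Ck lij).
Qed.

End IdealBasics.

(** * Associated primes, prime avoidance and the intersection theorem *)

Section Noetherian.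
Variable R : comNzRingType.
Hypothesis noethR : noetherian R.
Implicit Types (I J K L P Q : set R) (a b r t u v : R).

(** Otherwise choice gives a strictly ascending chain [C] of ideals at which [F] fails; the
    generators of its union all lie in one [C N], where the chain must stop. *)
Lemma noetherian_ind (F : set R -> Prop) :
  (forall J, is_ideal J ->
     (forall K, is_ideal K -> J `<=` K -> (exists2 t, K t & ~ J t) -> F K) ->
     F J) ->
  forall J, is_ideal J -> F J.
Proof.
move=> step J0 iJ0; apply: contrapT => nF0.
pose T := {J | is_ideal J /\ ~ F J}.
have next (J : T) : exists K : T,
    sval J `<=` sval K /\ exists2 t, sval K t & ~ sval J t.
  case: J => J [iJ nFJ] /=; apply: contrapT => h; apply: nFJ.
  apply: step => // K iK JK hK; apply: contrapT => nFK; apply: h.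
  by exists (exist _ K (conj iK nFK)).
have [f hf] := choice next.
pose C n := sval (iter n f (exist _ J0 (conj iJ0 nF0) : T)).
have iC n : is_ideal (C n) by have [] :=
  svalP (iter n f (exist _ J0 (conj iJ0 nF0) : T)).
have mono m n t : (m <= n)%N -> C m t -> C n t.
  elim: n => [|n IH]; first by rewrite leqn0 => /eqP->.
  rewrite leq_eqVlt => /orP[/eqP->//|lmn] Ct.
  by apply: (hf _).1; apply: IH.
pose U : set R := fun t => exists n, C n t.
have iU : is_ideal U.
  split; first by exists 0%N; apply: ideal_0.
    move=> a b [m hm] [n hn]; exists (maxn m n).
    by apply: ideal_add => //; [apply: mono hm|apply: mono hn];
      rewrite ?leq_maxl ?leq_maxr.
  by move=> r a [n hn]; exists n; apply: ideal_mull.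
have [s Us] := noethR iU.
have [N hN] : exists N, forall a, a \in s -> C N a.
  have : forall a, a \in s -> U a by move=> a ?; rewrite Us;
    apply: mem_ideal_gen.
  elim: s {Us} => [|a s IH] hs; first by exists 0%N.
  have [|N hN] := IH; first by move=> b bs; apply: hs; rewrite in_cons bs orbT.
  have [n hn] := hs a (mem_head _ _).
  exists (maxn n N) => b; rewrite in_cons => /orP[/eqP->|/hN].
    by apply: mono hn; rewrite leq_maxl.
  by apply: mono; rewrite leq_maxr.
have [_ [t Ct nCt]] := hf (iter N f (exist _ J0 (conj iJ0 nF0))).
apply: nCt; apply: (@ideal_gen_sub _ [set` s] (C N)) => //.
by rewrite -Us; exists N.+1.
Qed.

Lemma noetherian_max (F : set R -> Prop) J0 :
  (forall J, F J -> is_ideal J) -> F J0 ->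
  exists2 J, F J & forall K, F K -> J `<=` K -> K `<=` J.
Proof.
move=> iF F0; have iJ0 := iF _ F0.
pose G J0 := F J0 -> exists2 J, F J & forall K, F K -> J `<=` K -> K `<=` J.
suff : G J0 by apply.
move: J0 iJ0 {F0}; apply: noetherian_ind => J iJ IH FJ.
apply: contrapT => h; apply: (h); exists J => // K FK JK t Kt.
apply: contrapT => nJt; apply: h; apply: (IH K) => //; first exact: iF.
by exists t.
Qed.

Lemma colon_max J (C : R -> Prop) a0 : is_ideal J -> C a0 ->
  exists2 a, C a &
    forall b, C b -> colon J a `<=` colon J b -> colon J b `<=` colon J a.
Proof.
move=> iJ Ca0.
have [||_ [a Ca ->]] :=
  @noetherian_max (fun K => exists2 a, C a & K = colon J a) (colon J a0).
- by move=> _ [a _ ->]; apply: colon_ideal.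
- by exists a0.
- by move=> h; exists a => // b Cb; apply: h; exists b.
Qed.

(** An annihilator maximal among those of the nonzero multiples of [t] in R/J is prime. *)
Lemma colon_prime_multiple J t : is_ideal J -> ~ J t ->
  exists s, is_prime (colon J (t * s)).
Proof.
move=> iJ nJt.
have [|_ [[s ->] nJs] h] :=
  @colon_max J (fun a => (exists s, a = t * s) /\ ~ J a) t iJ.
  by split=> //; exists 1; rewrite mulr1.
exists s; split; first exact: colon_ideal.
  by rewrite /colon /= mul1r.
move=> a b ab; have [nb|] := pselect (~ colon J (t * s) b); last first.
  by move/contrapT; right.
left; apply: (h (t * s * b)); rewrite /colon /=.
- split; first by exists (s * b); rewrite mulrA.
  by rewrite mulrC.
- by move=> c Jc /=; rewrite mulrA; apply: ideal_mulr.
- by move: ab; rewrite /colon /=; congr (J _); ring.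
Qed.

(** A maximal annihilator among those inside [Q] is prime. Applied to a prime minimal over [J], this
    shows that it is associated to [J]. *)
Lemma colon_prime_inside J Q : is_ideal J -> is_prime Q -> J `<=` Q ->
  exists2 b, is_prime (colon J b) & colon J b `<=` Q.
Proof.
move=> iJ pQ JQ; have [_ Q1 QM] := pQ.
have [|a Ca h] := @colon_max J (fun a => colon J a `<=` Q) 1 iJ.
  by move=> t; rewrite /colon /= mulr1; apply: JQ.
exists a => //; split; first exact: colon_ideal.
  by move/Ca.
move=> b c bc.
have [sub|] := pselect (colon J (a * c) `<=` Q).
  left; apply: (h (a * c)) => //.
    by move=> t Jt; rewrite /colon /= mulrA; apply: ideal_mulr.
  by move: bc; rewrite /colon /=; congr (J _); ring.
move=> /existsNP[t /not_implyP[Jt nQt]]; right; apply: (h (a * t)).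
- move=> u Ju; have : Q (u * t).
    by apply: Ca; move: Ju; rewrite /colon /=; congr (J _); ring.
  by case/QM.
- by move=> u Ju; rewrite /colon /= mulrA; apply: ideal_mulr.
- by move: Jt; rewrite /colon /=; congr (J _); ring.
Qed.

Lemma colon_prime_eq J b t : is_prime (colon J b) -> ~ J (t * b) ->
  colon J (t * b) = colon J b.
Proof.
move=> [iC C1 CM] nJ; apply/seteqP; split=> u.
  by rewrite /colon /= mulrA => /CM[//|].
by move=> Ju; rewrite /colon /= mulrA [u * t]mulrC; apply: (ideal_mull t iC Ju).
Qed.

(** If (J : b1) is prime, any other prime (J : b) is associated to J + (b1): a multiple of [b] in J
    + (b1) but not in [J] would be a multiple of [b1] modulo [J], and its annihilator would be both
    primes. *)
Lemma colon_primes_finite J : is_ideal J ->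
  exists s : seq (set R), forall b, is_prime (colon J b) -> colon J b \in s.
Proof.
move: J; apply: noetherian_ind => J iJ IH.
have [[b1 p1]|no] := pselect (exists b, is_prime (colon J b)); last first.
  by exists [::] => b pb; case: no; exists b.
have [|||s hs] := IH (adjoin J b1).
- exact: adjoin_ideal.
- by move=> t; apply: sub_adjoin.
- exists b1; first exact: mem_adjoin.
  by case: p1 => _ h _; move: h; rewrite /colon /= mul1r.
exists (colon J b1 :: s) => b pb; rewrite in_cons.
have [[t nJ [r hr]]|no] :=
  pselect (exists2 t, ~ J (t * b) & adjoin J b1 (t * b)).
  have nJ1 : ~ J (r * b1) by move=> h; apply: nJ; apply: ideal_subr hr.
  apply/orP; left; apply/eqP.
  rewrite -(colon_prime_eq pb nJ) -(colon_prime_eq p1 nJ1).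
  apply/seteqP; split=> u; rewrite /colon /= => h.
    by rewrite -(subKr (u * (t * b)) (u * (r * b1))) -mulrBr;
      apply: ideal_sub => //; apply: ideal_mull.
  rewrite -(subrK (u * (r * b1)) (u * (t * b))) -mulrBr.
  by apply: ideal_add => //; apply: ideal_mull.
have e : colon (adjoin J b1) b = colon J b.
  apply/seteqP; split=> t; last by move=> h; apply: sub_adjoin.
  by move=> h; apply: contrapT => nJ; apply: no; exists t.
by apply/orP; right; rewrite -e; apply: hs; rewrite e.
Qed.

(* A prime of the list that is contained in another one can be dropped; if no *)
(* prime of the tail lies in the head [P], an element found for the tail is   *)
(* corrected by a product that lies in the whole tail but not in [P].         *)
Lemma coset_avoidance (s : seq (set R)) v K : is_ideal K ->
  (forall Q, Q \in s -> is_prime Q /\ ~ (Q v /\ K `<=` Q)) ->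
  exists2 a, K a & forall Q, Q \in s -> ~ Q (v + a).
Proof.
move=> iK; have [n] := ubnP (size s); elim: n s => // n IH [|P s] /= sn hs.
  by exists 0 => //; apply: ideal_0.
have [[Q [Qs nQP QP]]|no] :=
  pselect (exists Q, [/\ Q \in s, Q != P & Q `<=` P]).
  have [|Q' hQ'|a Ka ha] := IH (P :: rem Q s).
  - by rewrite /= size_rem // prednK // ?(leq_trans _ sn) // lt0n size_eq0;
      case: (s) Qs.
  - by apply: hs; move: hQ'; rewrite !in_cons => /orP[->//|/mem_rem->];
      rewrite orbT.
  exists a => // Q'; rewrite in_cons => /orP[/eqP->|Q's].
    by apply: ha; rewrite mem_head.
  have [->|nQ] := eqVneq Q' Q; first by move=> /QP; apply: ha; rewrite mem_head.
  apply: ha; rewrite in_cons; apply/orP; right; move: Q's.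
  by rewrite (perm_mem (perm_to_rem Qs)) in_cons (negbTE nQ).
have [|Q hQ|a Ka ha] := IH s; first by rewrite -ltnS.
  by apply: hs; rewrite in_cons hQ orbT.
have [Pva|nPva] := pselect (P (v + a)); last first.
  by exists a => // Q; rewrite in_cons => /orP[/eqP->|/ha].
have [pP nP] := hs P (mem_head _ _); have iP := prime_ideal pP.
have [a0 Ka0 nPa0] : exists2 t, K t & ~ P t.
  have [sub|/existsNP[t /not_implyP[? ?]]] := pselect (K `<=` P);
    last by exists t.
  case: nP; split=> //; by rewrite -(addrK a v); apply: ideal_sub (sub _ Ka).
have [t nPt ht] : exists2 t, ~ P t & forall Q, Q \in s -> Q != P -> Q t.
  have : forall Q, Q \in s -> is_prime Q /\ (Q != P -> ~ (Q `<=` P)).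
    move=> Q Qs; split; first by apply: (hs Q _).1; rewrite in_cons Qs orbT.
    by move=> nQ sub; apply: no; exists Q.
  elim: s {IH sn hs no ha} => [|Q s IH] hs.
    by exists 1 => //; case: pP.
  have [|t nPt ht] := IH; first by move=> Q' ?; apply: hs;
    rewrite in_cons orbC; apply/orP; left.
  have [pQ hQ] := hs Q (mem_head _ _).
  have [->|nQP] := eqVneq Q P.
    by exists t => // Q'; rewrite in_cons => /orP[/eqP->|];
      [rewrite eqxx|apply: ht].
  have /existsNP[q /not_implyP[Qq nPq]] := hQ nQP.
  exists (q * t); first by case: pP => _ _ h /h[].
  move=> Q'; rewrite in_cons => /orP[/eqP->|Qs] nQ'P.
    by apply: ideal_mulr => //; apply: prime_ideal.
  apply: ideal_mull; last exact: ht.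
  by apply: prime_ideal; apply: (hs Q' _).1; rewrite in_cons Qs orbT.
have nPva : ~ P (v + (a + t * a0)).
  move=> h; have : P (t * a0).
    by rewrite (_ : t * a0 = v + (a + t * a0) - (v + a));
      [apply: ideal_sub|ring].
  by case: pP => _ _ hM /hM[].
exists (a + t * a0); first by apply: ideal_add => //; apply: ideal_mull.
move=> Q; have [->//|nQP] := eqVneq Q P;
  rewrite in_cons (negbTE nQP) /= => Qs h.
have pQ : is_prime Q by apply: (hs Q _).1; rewrite in_cons Qs orbT.
apply: (ha Q Qs); rewrite (_ : v + a = v + (a + t * a0) - t * a0); last by ring.
by apply: ideal_sub => //; [apply: prime_ideal|apply: ideal_mulr;
  [apply: prime_ideal|apply: ht]].
Qed.

Definition regular_mod J u : Prop := forall t, J (u * t) -> J t.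

Lemma regular_mod_colon_prime J u b : regular_mod J u ->
  is_prime (colon J b) -> ~ colon J b u.
Proof. by move=> reg [_ C1 _] /reg h; apply: C1; rewrite /colon /= mul1r. Qed.

(** Every zero divisor on R/J lies in one of the finitely many associated primes of [J], and
    avoidance finds an element of v + K outside them all. *)
Lemma regular_mod_exists J K v : is_ideal J -> is_ideal K ->
  (forall b, is_prime (colon J b) -> ~ (colon J b v /\ K `<=` colon J b)) ->
  exists2 a, K a & regular_mod J (v + a).
Proof.
move=> iJ iK h; have [s hs] := colon_primes_finite iJ.
have [Q|a Ka ha] := @coset_avoidance
    [seq Q <- s | `[< exists2 b,
      is_prime (colon J b) & Q = colon J b >]] v K iK.
  by rewrite mem_filter => /andP[/asboolP[b pb ->] _]; split=> //; apply: h.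
exists a => // t Jt; apply: contrapT => nJt.
have [c pc] := colon_prime_multiple iJ nJt.
apply: (ha (colon J (t * c))).
  by rewrite mem_filter hs // andbT; apply/asboolP; exists (t * c).
by rewrite /colon /= mulrA; apply: ideal_mulr.
Qed.

Section Local.
Variable M : set R.
Hypotheses (iM : is_ideal M) (M1 : ~ M 1)
  (maxM : forall K, is_ideal K -> ~ K 1 -> K `<=` M).

Lemma local_unit t : ~ M t -> exists r, r * t = 1.
Proof.
move=> nMt; apply: contrapT => h; apply: nMt.
have iK := adjoin_ideal t (is_ideal_set0 R).
apply: (maxM iK); last exact/mem_adjoin/is_ideal_set0.
by move=> [r hr]; apply: h; exists r; apply/esym/eqP; rewrite -subr_eq0;
  apply/eqP.
Qed.

(** An ideal [J] maximal among those that contain L + M r and miss [r] contains a power of every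
    element of [M], so it would be one of the [K] in the hypothesis. *)
Lemma krull_intersection L r (s : seq R) : is_ideal L ->
  (forall y, y \in s -> M y) ->
  (forall N K, is_ideal K -> L `<=` K ->
     (forall y, y \in s -> K (y ^+ N)) -> K r) ->
  L r.
Proof.
move=> iL sM h; apply: contrapT => nLr.
(* This is L + M r, which misses [r] by Nakayama's lemma. *)
pose L1 : set R := fun t => exists2 mu, M mu & L (t - mu * r).
have [J [iJ L1J nJr] maxJ] : exists2 J, [/\ is_ideal J, L1 `<=` J & ~ J r] &
    forall K, [/\ is_ideal K, L1 `<=` K & ~ K r] -> J `<=` K -> K `<=` J.
  apply: (@noetherian_max _ L1) => [J []//|]; split=> //.
    split.
    - by exists 0; [exact: ideal_0|rewrite mul0r subr0; apply: ideal_0].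
    - move=> a b [x Mx hx] [y My hy]; exists (x + y); first exact: ideal_add.
      by have := ideal_add iL hx hy; congr (L _); ring.
    - move=> c a [x Mx hx]; exists (c * x); first exact: ideal_mull.
      by have := ideal_mull c iL hx; congr (L _); ring.
  move=> [mu Mmu hmu].
  have [|c hc] := @local_unit (1 - mu).
    by move=> h1; apply: M1; rewrite -(subrK mu 1); apply: ideal_add.
  apply: nLr; rewrite -[r]mul1r -hc -mulrA; apply: ideal_mull => //.
  by rewrite mulrBl mul1r.
have LJ : L `<=` J.
  move=> t Lt; apply: L1J; exists 0; first exact: ideal_0.
  by rewrite mul0r subr0.
(* Take [k] with (J : y^k) maximal. If y^k is not in [J], then r = s' y^k modulo [J]; as y r is in
   [J], s' lies in (J : y^(k+1)) = (J : y^k), which puts [r] in [J]. *)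
have pow y : M y -> exists k, J (y ^+ k).
  move=> My; have [|_ [k ->] hk] :=
    @colon_max J (fun a => exists k, a = y ^+ k) 1 iJ.
    by exists 0%N.
  exists k; apply: contrapT => nJy; apply: nJy.
  have [//|nJy] := pselect (J (y ^+ k)).
  have [s' hs'] : adjoin J (y ^+ k) r.
    apply: contrapT => nr; apply: nJy.
    apply: (maxJ (adjoin J (y ^+ k))); last exact: mem_adjoin.
      by split=> //; [apply: adjoin_ideal|move=> t /L1J; apply: sub_adjoin].
    exact: sub_adjoin.
  case: nJr; apply: (ideal_subr iJ _ hs').
  apply: (hk (y ^+ k.+1)); first by exists k.+1.
    move=> c; rewrite /colon /= => hc.
    by rewrite exprS mulrCA; apply: ideal_mull.
  have Jyr : J (y * r).
    by apply: L1J; exists y => //; rewrite subrr; apply: ideal_0.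
  have := ideal_sub iJ Jyr (ideal_mull y iJ hs').
  by rewrite /colon /=; congr (J _); rewrite exprS; ring.
have [N hN] : exists N, forall y, y \in s -> J (y ^+ N).
  elim: s sM {h} => [|y s IH] sM; first by exists 0%N.
  have [|N hN] := IH; first by move=> z zs; apply: sM; rewrite in_cons zs orbT.
  have [k hk] := pow y (sM y (mem_head _ _)).
  exists (k + N)%N => z; rewrite in_cons exprD => /orP[/eqP->|/hN ?].
    exact: ideal_mulr.
  exact: ideal_mull.
by apply: nJr; apply: (h N).
Qed.

End Local.
End Noetherian.

Lemma local_ringP (R : comNzRingType) (m : idealr R) : noetherian R ->
  local_ring m -> forall K : set R, is_ideal K -> ~ K 1 -> K `<=` [set` m].
Proof.
move=> noethR [maxm uniqm] K iK K1.
have [J [iJ KJ J1] maxJ] : exists2 J, [/\ is_ideal J, K `<=` J & ~ J 1] &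
    forall J', [/\ is_ideal J', K `<=` J' & ~ J' 1] -> J `<=` J' -> J' `<=` J.
  by apply: (@noetherian_max _ noethR _ K) => [J []//|]; split.
have [m' hm'] := idealr_of iJ J1.
have em : m' =i m.
  apply: uniqm => I sub t tI; rewrite hm'; apply/asboolP.
  apply: (maxJ [set` I]) => //=.
    split; first exact: idealr_is_ideal.
      by move=> u /KJ Ju /=; apply: sub; rewrite hm'; apply/asboolP.
    by rewrite /= idealr1.
  by move=> u Ju /=; apply: sub; rewrite hm'; apply/asboolP.
by move=> t /KJ Jt /=; rewrite -em hm'; apply/asboolP.
Qed.

(** * Koszul homology *)

Section Koszul.
Variable R : comNzRingType.
Implicit Types (J K : set R) (w : seq R) (a b e g : bitseq -> R) (s : bitseq).
Implicit Types (c r t u : R) (i k : nat).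

(* A Koszul chain on [w] is given by its coefficients, indexed by the subsets *)
(* of the positions of [w], encoded as bit sequences of length [size w].      *)
Fixpoint koszul_diff w a s : R :=
  match w, s with
  | u :: w', false :: s' =>
      koszul_diff w' (fun s => a (false :: s)) s' + u * a (true :: s')
  | _ :: w', true :: s' => - koszul_diff w' (fun s => a (true :: s)) s'
  | _, _ => 0
  end.

Definition homogeneous k i a : Prop :=
  forall s, ~~ ((size s == k) && (count id s == i)) -> a s = 0.

(* [c] annihilates the [i]-th Koszul homology of [w] on [R / J].              *)
Definition koszul_kills w J i c : Prop :=
  forall a, homogeneous (size w) i a -> (forall s, J (koszul_diff w a s)) ->
  exists2 b, homogeneous (size w) i.+1 b &
    forall s, J (c * a s - koszul_diff w b s).

Lemma koszul_diff_linear w r a b s :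
  koszul_diff w (fun s => r * a s + b s) s =
  r * koszul_diff w a s + koszul_diff w b s.
Proof.
elim: w a b s => [|u w IH] a b [|[] s] /=; try by ring.
  by rewrite IH; ring.
by rewrite (IH (fun s => a (false :: s)) (fun s => b (false :: s))); ring.
Qed.

Lemma koszul_diff0 w s : koszul_diff w (fun=> 0) s = 0.
Proof.
elim: w s => [|u w IH] [|[] s] //=; first by rewrite IH oppr0.
by rewrite IH mulr0 addr0.
Qed.

Lemma koszul_diffZ w r a s :
  koszul_diff w (fun s => r * a s) s = r * koszul_diff w a s.
Proof.
rewrite -[RHS]addr0 -(koszul_diff0 w s) -koszul_diff_linear.
by congr (koszul_diff _ _ _); apply/funext => s'; rewrite addr0.
Qed.

Lemma koszul_diffB w a b s :
  koszul_diff w (fun s => a s - b s) s = koszul_diff w a s - koszul_diff w b s.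
Proof.
rewrite -[X in _ = _ - X]mul1r -mulNr [RHS]addrC -koszul_diff_linear.
by congr (koszul_diff _ _ _); apply/funext => s'; ring.
Qed.

Lemma koszul_diffN w a s :
  koszul_diff w (fun s => - a s) s = - koszul_diff w a s.
Proof.
rewrite -mulN1r -koszul_diffZ.
by congr (koszul_diff _ _ _); apply/funext => s'; ring.
Qed.

Lemma koszul_diff_diff w a s : koszul_diff w (koszul_diff w a) s = 0.
Proof.
elim: w a s => [|u w IH] a [|[] s] //=.
  by rewrite koszul_diffN IH !oppr0.
rewrite (_ : (fun s0 => _) = fun s => u * a (true :: s) +
    koszul_diff w (fun s => a (false :: s)) s); last first.
  by apply/funext => s'; rewrite addrC.
by rewrite koszul_diff_linear IH; ring.
Qed.

Lemma koszul_diff_ideal w J a : is_ideal J ->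
  (forall s, J (a s)) -> forall s, J (koszul_diff w a s).
Proof.
move=> iJ; elim: w a => [|u w IH] a Ja [|[] s] /=; try exact: ideal_0.
  by apply: ideal_opp => //; apply: IH.
by apply: ideal_add => //; [apply: IH|apply: ideal_mull].
Qed.

Lemma koszul_diff_mem w J a s : is_ideal J ->
  (forall u, u \in w -> J u) -> J (koszul_diff w a s).
Proof.
move=> iJ; elim: w a s => [|u w IH] a [|[] s] Jw /=; try exact: ideal_0.
  by apply: ideal_opp => //; apply: IH => v vw; apply: Jw;
    rewrite in_cons vw orbT.
apply: ideal_add => //; last by apply: ideal_mulr => //; apply: Jw;
  rewrite mem_head.
by apply: IH => v vw; apply: Jw; rewrite in_cons vw orbT.
Qed.

Lemma homogeneous_false k i a : homogeneous k.+1 i a ->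
  homogeneous k i (fun s => a (false :: s)).
Proof. by move=> ha s hs; apply: ha; rewrite /= eqSS add0n. Qed.

Lemma homogeneous_true k i a : homogeneous k.+1 i.+1 a ->
  homogeneous k i (fun s => a (true :: s)).
Proof. by move=> ha s hs; apply: ha; rewrite /= eqSS add1n eqSS. Qed.

Lemma koszul_diff_degree0 w a s : homogeneous (size w) 0 a ->
  koszul_diff w a s = 0.
Proof.
elim: w a s => [|u w IH] a [|[] s] //= ha.
  rewrite (_ : (fun s => _) = fun=> 0) ?koszul_diff0 ?oppr0 //.
  by apply/funext => s'; apply: ha; rewrite /= andbF.
rewrite IH; last exact: homogeneous_false.
by rewrite ha ?mulr0 ?addr0 //= andbF.
Qed.

Lemma homogeneous_diff w i a : homogeneous (size w) i.+1 a ->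
  homogeneous (size w) i (koszul_diff w a).
Proof.
elim: w i a => [|u w IH] i a ha [|[] s] //=.
  case: i ha => [|i] ha hs.
    by rewrite koszul_diff_degree0 ?oppr0 //; apply: homogeneous_true.
  rewrite (IH i) ?oppr0 //; first exact: homogeneous_true.
rewrite eqSS add0n => hs; rewrite (IH i) //; last exact: homogeneous_false.
by rewrite ha ?mulr0 ?addr0 //= eqSS add1n eqSS.
Qed.

Lemma homogeneous_large k i a : (k < i)%N -> homogeneous k i a ->
  forall s, a s = 0.
Proof.
move=> ki ha s; apply: ha; apply/negP => /andP[/eqP sk /eqP si].
by have := count_size id s; rewrite si sk leqNgt ki.
Qed.

Lemma koszul_kills_large w J i : is_ideal J -> (size w < i)%N ->
  koszul_kills w J i 1.
Proof.
move=> iJ wi a ha _; exists (fun=> 0) => // s.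
by rewrite (homogeneous_large wi ha) koszul_diff0 mulr0 subrr; apply: ideal_0.
Qed.

Lemma homogeneous_adjoin J u k i a : is_ideal J -> homogeneous k i a ->
  (forall s, adjoin J u (a s)) ->
  exists2 g, homogeneous k i g & forall s, J (a s - u * g s).
Proof.
move=> iJ ha Ja.
have h s : exists r, J (a s - u * r) /\
    (~~ ((size s == k) && (count id s == i)) -> r = 0).
  case hs: (_ && _).
    by have [r hr] := Ja s; exists r; rewrite mulrC.
  by exists 0; rewrite ha ?hs // mulr0 subrr; split=> //; apply: ideal_0.
have [g hg] := choice h.
by exists g => s; [apply: (hg s).2|apply: (hg s).1].
Qed.

(** This lemma and the next two chase the long exact sequence of 0 -> R/(J : u) -> R/J -> R/(J +
    (u)) -> 0, whose first map is multiplication by [u]. Here the middle term is treated. *)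
Lemma koszul_kills_extension w J u i c c' : is_ideal J ->
  koszul_kills w (colon J u) i c -> koszul_kills w (adjoin J u) i c' ->
  koszul_kills w J i (c * c').
Proof.
move=> iJ kC kA e he Je.
have iA := adjoin_ideal u iJ.
have [|b hb Ab] := kA e he; first by move=> s; apply: sub_adjoin.
have hd : homogeneous (size w) i (fun s => c' * e s - koszul_diff w b s).
  by move=> s hs; rewrite he // (homogeneous_diff hb) // mulr0 subrr.
have [g hg Jg] := homogeneous_adjoin iJ hd Ab.
have [|b' hb' Jb'] := kC g hg.
  move=> s; rewrite /colon /=.
  have h1 := koszul_diff_ideal w iJ Jg s.
  rewrite !koszul_diffB !koszul_diffZ koszul_diff_diff in h1.
  have := ideal_sub iJ (ideal_mull c' iJ (Je s)) h1.
  by congr (J _); ring.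
exists (fun s => c * b s + u * b' s).
  by move=> s hs; rewrite hb // hb' // !mulr0 addr0.
move=> s; rewrite koszul_diff_linear koszul_diffZ.
have := ideal_add iJ (ideal_mull c iJ (Jg s)) (Jb' s).
by congr (J _); ring.
Qed.

(** A chain [b] with boundary c u e is a cycle modulo J + (u), so c' b is a boundary plus u g, and
    [g] bounds c c' e modulo (J : u). *)
Lemma koszul_kills_colon w J u i c c' : is_ideal J ->
  koszul_kills w J i c -> koszul_kills w (adjoin J u) i.+1 c' ->
  koszul_kills w (colon J u) i (c * c').
Proof.
move=> iJ kJ kA e he Ce.
have iA := adjoin_ideal u iJ.
have [||b hb Jb] := kJ (fun s => u * e s).
- by move=> s hs; rewrite he // mulr0.
- by move=> s; rewrite koszul_diffZ mulrC; apply: Ce.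
have [|f hf Af] := kA b hb.
  move=> s; apply: (adjoin_sub iA (@sub_adjoin _ J u) (mem_adjoin u iJ)).
  exists (c * e s).
  have := ideal_opp iJ (Jb s).
  by congr (J _); ring.
have hd : homogeneous (size w) i.+1 (fun s => c' * b s - koszul_diff w f s).
  by move=> s hs; rewrite hb // (homogeneous_diff hf) // mulr0 subrr.
have [g hg Jg] := homogeneous_adjoin iJ hd Af.
exists g => // s; rewrite /colon /=.
have h1 := koszul_diff_ideal w iJ Jg s.
rewrite !koszul_diffB !koszul_diffZ koszul_diff_diff in h1.
have := ideal_add iJ h1 (ideal_mull c' iJ (Jb s)).
by congr (J _); ring.
Qed.

(** The boundary of [e] is u g modulo [J]; the connecting map sends [e] to [g]. *)
Lemma koszul_kills_adjoin w J u i c c' : is_ideal J ->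
  koszul_kills w J i.+1 c -> koszul_kills w (colon J u) i c' ->
  koszul_kills w (adjoin J u) i.+1 (c * c').
Proof.
move=> iJ kJ kC e he Ae.
have [g hg Jg] := homogeneous_adjoin iJ (homogeneous_diff he) Ae.
have [|b hb Cb] := kC g hg.
  move=> s; rewrite /colon /=.
  have h1 := koszul_diff_ideal w iJ Jg s.
  rewrite !koszul_diffB !koszul_diffZ koszul_diff_diff in h1.
  have := ideal_opp iJ h1.
  by congr (J _); ring.
have [||f hf Jf] := kJ (fun s => c' * e s - u * b s).
- by move=> s hs; rewrite he // hb // !mulr0 subrr.
- move=> s; rewrite koszul_diffB !koszul_diffZ.
  have := ideal_add iJ (ideal_mull c' iJ (Jg s)) (Cb s).
  by congr (J _); ring.
exists f => // s; exists (c * b s).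
by have := Jf s; congr (J _); ring.
Qed.

Lemma regular_colon J u : is_ideal J -> regular_mod J u ->
  colon J u = J.
Proof.
move=> iJ reg; apply/seteqP; split=> t; last exact: ideal_mulr.
by rewrite /colon /= mulrC; apply: reg.
Qed.

(** The part of a cycle without [u] is a cycle on [w] modulo J + (u), hence the boundary of [e] plus
    u g. Then [e] and [g] together bound the whole cycle; for the part with [u] this follows by
    cancelling [u] modulo [J]. *)
Lemma koszul_kills_cons u w J i : is_ideal J ->
  regular_mod J u ->
  koszul_kills w (adjoin J u) i.+1 1 -> koszul_kills (u :: w) J i.+1 1.
Proof.
move=> iJ reg kA a ha Ja.
have ha0 := homogeneous_false ha; have ha1 := homogeneous_true ha.
have iA := adjoin_ideal u iJ.
have [|e he Ae] := kA _ ha0.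
  move=> s; exists (- a (true :: s)); have := Ja (false :: s).
  by rewrite /=; congr (J _); ring.
have hd : homogeneous (size w) i.+1 (fun s =>
  1 * a (false :: s) - koszul_diff w e s).
  by move=> s hs; rewrite ha0 // (homogeneous_diff he) // mulr0 subrr.
have [g hg Jg] := homogeneous_adjoin iJ hd Ae.
exists (fun s => match s with
  | [::] => 0 | false :: s => e s | true :: s => g s end).
  move=> [//|[] s] /=; rewrite eqSS ?add1n ?add0n ?eqSS; first exact: hg.
  exact: he.
move=> [|[] s] /=.
- by rewrite ha // mulr0 subr0; apply: ideal_0.
- apply: reg.
  have h1 := koszul_diff_ideal w iJ Jg s.
  rewrite !koszul_diffB !koszul_diffZ koszul_diff_diff in h1.
  have := ideal_sub iJ (Ja (false :: s)) h1.
  by rewrite /=; congr (J _); ring.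
- by have := Jg s; congr (J _); ring.
Qed.

(** The chain with [t] at the full subset is a cycle, and no nonzero chain of higher degree exists
    to bound it. *)
Lemma koszul_kills_top w J t : is_ideal J -> koszul_kills w J (size w) 1 ->
  (forall u, u \in w -> J (u * t)) -> J t.
Proof.
move=> iJ kJ Jt; pose top k s := if s == nseq k true then t else 0.
have htop : homogeneous (size w) (size w) (top (size w)).
  move=> s; rewrite /top; case: (s =P _) => // ->.
  by rewrite size_nseq count_nseq mul1n eqxx.
have [|b hb Jb] := kJ _ htop.
  elim: w {kJ htop} Jt => [|u w IH] Jt [|[] s] /=; try exact: ideal_0.
    apply: ideal_opp => //; apply: IH => v vw.
    by apply: Jt; rewrite in_cons vw orbT.
  rewrite (_ : (fun s => _) = fun=> 0) // koszul_diff0 add0r /top.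
  case: eqP => _; last by rewrite mulr0; apply: ideal_0.
  by apply: Jt; rewrite mem_head.
have := Jb (nseq (size w) true).
rewrite (_ : b = fun=> 0); last by apply/funext; apply: homogeneous_large hb.
by rewrite koszul_diff0 subr0 mul1r /top eqxx.
Qed.

(** The ideal J + (w). The head is adjoined last, so that membership gives its coefficient first, as
    in the recursion of [koszul_diff]. *)
Fixpoint ideal_seq J w : set R :=
  if w is u :: w' then adjoin (ideal_seq J w') u else J.

Lemma ideal_seq_ideal J w : is_ideal J -> is_ideal (ideal_seq J w).
Proof. by move=> iJ; elim: w => //= u w; apply: adjoin_ideal. Qed.

Lemma sub_ideal_seq J w : J `<=` ideal_seq J w.
Proof. by elim: w => //= u w IH t /IH; apply: sub_adjoin. Qed.

Lemma mem_ideal_seq J w u : is_ideal J -> u \in w -> ideal_seq J w u.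
Proof.
move=> iJ; elim: w => //= v w IH; rewrite in_cons => /orP[/eqP->|/IH].
  exact/mem_adjoin/ideal_seq_ideal.
exact: sub_adjoin.
Qed.

Lemma ideal_seq_sub J w K : is_ideal K -> J `<=` K ->
  (forall u, u \in w -> K u) -> ideal_seq J w `<=` K.
Proof.
move=> iK JK; elim: w => //= u w IH wK; apply: adjoin_sub => //.
  by apply: IH => v vw; apply: wK; rewrite in_cons vw orbT.
by apply: wK; rewrite mem_head.
Qed.

Let const k t s : R := if s == nseq k false then t else 0.

Lemma homogeneous_const k t : homogeneous k 0 (const k t).
Proof.
move=> s; rewrite /const; case: (s =P _) => // ->.
by rewrite size_nseq count_nseq !eqxx.
Qed.

Lemma koszul_diff_onto w J t : is_ideal J -> ideal_seq J w t ->
  exists2 a, homogeneous (size w) 1 a &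
    forall s, J (koszul_diff w a s - const (size w) t s).
Proof.
move=> iJ; elim: w t => [|u w IH] t /=.
  move=> Jt; exists (fun=> 0) => // s; rewrite /const /=.
  by case: eqP => _; rewrite ?subr0 ?sub0r; [apply: ideal_opp|apply: ideal_0].
move=> [r /IH[a ha Ja]].
exists (fun s => match s with
  | [::] => 0 | false :: s => a s | true :: s => const (size w) r s end).
  move=> [//|[] s] /=; rewrite eqSS ?add1n ?add0n ?eqSS; last exact: ha.
  exact: homogeneous_const.
move=> [|[] s] /=.
- by rewrite subr0; apply: ideal_0.
- rewrite (_ : const _ _ (true :: s) = 0) // koszul_diff_degree0 ?oppr0 ?addr0;
    first exact: ideal_0.
  exact: homogeneous_const.
- have := Ja s; congr (J _); rewrite /const eqseq_cons eqxx /=.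
  by case: eqP => _; ring.
Qed.

(** A relation u r in J + (w) is a cycle of degree 1 with coefficient [r] at [u]. Once [c] makes it
    a boundary, its coefficient at [u] is, modulo [J] and up to sign, a boundary on [w], so it lies
    in J + (w). *)
Lemma koszul_kills_colon1 u w J c r : is_ideal J ->
  koszul_kills (u :: w) J 1 c -> ideal_seq J w (u * r) -> ideal_seq J w (c * r).
Proof.
move=> iJ kJ hr.
have iw := ideal_seq_ideal w iJ.
have [a ha Ja] := koszul_diff_onto iJ (ideal_opp iw hr).
have [||b hb Jb] := kJ (fun s => match s with
  | [::] => 0 | false :: s => a s | true :: s => const (size w) r s end).
- move=> [//|[] s] /=; rewrite eqSS ?add1n ?add0n ?eqSS; last exact: ha.
  exact: homogeneous_const.
- move=> [|[] s] /=.
  + exact: ideal_0.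
  + rewrite koszul_diff_degree0 ?oppr0; first exact: ideal_0.
    exact: homogeneous_const.
  + by have := Ja s; congr (J _); rewrite /const; case: eqP => _; ring.
have := @sub_ideal_seq J w _ (Jb (true :: nseq (size w) false)).
rewrite /= {1}/const eqxx => h.
have h' : ideal_seq J w (koszul_diff w (fun s =>
  b (true :: s)) (nseq (size w) false)).
  by apply: koszul_diff_mem => // v vw; apply: mem_ideal_seq.
by have := ideal_sub iw h h'; congr (ideal_seq J w _); ring.
Qed.

End Koszul.

(** * Uniform annihilators over a Cohen-Macaulay local ring *)

Fixpoint all2P (T U : Type) (r : T -> U ->
  Prop) (s : seq T) (t : seq U) : Prop :=
  match s, t with
  | [::], [::] => True
  | x :: s', y :: t' => r x y /\ all2P r s' t'
  | _, _ => False
  end.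

Lemma all2P_size (T U : Type) (r : T -> U -> Prop) s t :
  all2P r s t -> size s = size t.
Proof. by elim: s t => [|x s IH] [|y t] //= [_ /IH->]. Qed.

Definition is_power (R : comNzRingType) (u v : R) : Prop :=
  exists n, v = u ^+ n.+1.

Section RegularSequences.
Variable R : comNzRingType.
Implicit Types (J K : set R) (u t : R) (w x : seq R).

Fixpoint regular_seq J w : Prop :=
  if w is u :: w' then regular_mod J u /\ regular_seq (adjoin J u) w' else True.

Lemma foldl_adjoin_ideal J w : is_ideal J -> is_ideal (foldl (@adjoin R) J w).
Proof. by elim: w J => //= u w IH J iJ; apply/IH/adjoin_ideal. Qed.

Lemma foldl_adjoin_gen w : foldl (@adjoin R) [set 0] w = ideal_gen [set` w].
Proof.
have i0 := is_ideal_set0 R.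
apply/seteqP; split=> t.
  have sub J K : is_ideal K -> J `<=` K -> (forall u, u \in w -> K u) ->
      foldl (@adjoin R) J w `<=` K.
    move=> iK; elim: w J {t} => //= u w IH J JK wK; apply: IH.
      by apply: adjoin_sub => //; apply: wK; rewrite mem_head.
    by move=> v vw; apply: wK; rewrite in_cons vw orbT.
  apply: sub; first exact: ideal_gen_ideal.
    by move=> u ->; apply: (ideal_0 (ideal_gen_ideal _)).
  by move=> u uw; apply: mem_ideal_gen.
apply: ideal_gen_sub; first exact: foldl_adjoin_ideal.
have mono J v : J v -> foldl (@adjoin R) J w v.
  by elim: w J {t} => //= u w IH J Jv; apply/IH/sub_adjoin.
move=> v /= vw; elim: w [set 0] i0 vw {t mono} => //= u w IH J iJ.
have iA := adjoin_ideal u iJ.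
rewrite in_cons => /orP[/eqP->|vw]; last exact: IH.
have := mem_adjoin u iJ; move: (adjoin J u) => A Au.
by elim: w A Au {IH iA} => //= z w IH A Av; apply/IH/sub_adjoin.
Qed.

Lemma regular_sequence_seq (m : idealr R) w :
  regular_sequence m w -> regular_seq [set 0] w.
Proof.
move=> [_ h].
suff {h} : forall J, (forall i t, (i < size w)%N ->
    foldl (@adjoin R) J (take i w) (w`_i * t) ->
    foldl (@adjoin R) J (take i w) t) -> regular_seq J w.
  by apply=> i t; rewrite foldl_adjoin_gen; apply: h.
elim: w => //= u w IH J h; split.
  by move=> t; apply: (h 0%N).
by apply: IH => i t iw; apply: (h i.+1).
Qed.

Lemma koszul_kills_regular_powers J x w : is_ideal J -> regular_seq J x ->
  all2P (@is_power R) x w -> forall i, koszul_kills w J i.+1 1.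
Proof.
elim: x J w => [|u x IH] J [|v w] //= iJ.
  by move=> _ _ i; apply: koszul_kills_large.
move=> [reg regx] [[n ->] xw] i.
have regn m : regular_mod J (u ^+ m).
  elim: m => [|m IHm] t; first by rewrite expr0 mul1r.
  by rewrite exprS -mulrA => /reg/IHm.
apply: koszul_kills_cons => //.
(* Multiplication by [u] embeds R/(J + (u^(n+1))) in R/(J + (u^(n+2))) with cokernel R/(J + (u)). *)
elim: n => [|n IHn]; first by rewrite expr1; apply: IH => //;
  apply: adjoin_ideal.
have iK := adjoin_ideal (u ^+ n.+2) iJ.
rewrite -[1]mulr1; apply: (koszul_kills_extension (u := u)) => //.
  rewrite (_ : colon _ _ = adjoin J (u ^+ n.+1)) //.
  apply/seteqP; split=> t [r hr]; exists r.
    by apply: reg; move: hr; congr (J _); rewrite [u ^+ n.+2]exprS; ring.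
  by have := ideal_mull u iJ hr; congr (J _); rewrite [u ^+ n.+2]exprS; ring.
rewrite (_ : adjoin _ _ = adjoin J u); first by apply: IH => //;
  apply: adjoin_ideal.
have iA := adjoin_ideal u iJ.
apply/seteqP; split=> t.
  apply: adjoin_sub => //; last exact: mem_adjoin.
  apply: adjoin_sub => //; first by move=> s; apply: sub_adjoin.
  by rewrite exprS; apply: ideal_mulr => //; apply: mem_adjoin.
apply: adjoin_sub; first exact: adjoin_ideal.
  by move=> s Js; do 2!apply: sub_adjoin.
exact: mem_adjoin.
Qed.

Lemma koszul_kills_mem w K i c : is_ideal K -> K c -> koszul_kills w K i c.
Proof.
move=> iK Kc a _ _; exists (fun=> 0) => // s.
by rewrite koszul_diff0 subr0; apply: ideal_mulr.
Qed.

(* Descending induction on [i]: [R / P] embeds in [R / J] with cokernel of    *)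
(* the form [R / J'], so that its [i]-th homology is a quotient of the        *)
(* [i.+1]-st homology of [R / J'].                                            *)
Lemma koszul_uniform_killer (d i : nat) J P (W : set (seq R)) :
  noetherian R -> is_ideal J -> is_prime P -> J `<=` P ->
  (forall Q, is_prime Q -> J `<=` Q -> Q `<=` P -> P `<=` Q) ->
  (forall w, W w -> size w = d /\ forall i, koszul_kills w J i.+1 1) ->
  forall K, is_ideal K -> J `<=` K ->
  exists2 c, ~ P c & forall w, W w -> koszul_kills w K i.+1 c.
Proof.
move=> noethR iJ pP JP minP hW; have [_ P1 PM] := pP.
(* When [n], a bound for d - i, is 0, the degree i + 1 exceeds d and the homology vanishes. *)
move: {2}(d - i)%N (leqnn (d - i)) => n; elim: n i => [|n IHn] i hn K iK.
  move=> _; exists 1 => // w /hW[sw _]; apply: koszul_kills_large => //.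
  by rewrite sw; lia.
move: K iK; apply: (noetherian_ind noethR) => K iK IH JK.
have [K1|K1] := pselect (K 1).
  by exists 1 => // w _; apply: koszul_kills_mem.
(* For [K] not prime, (K : a) and K + (a) are both larger than [K], and the product of their killers
   works for [K]. *)
have [[a [b [Kab nKa nKb]]]|no] :=
    pselect (exists a b, [/\ K (a * b), ~ K a & ~ K b]).
  have [||||c nPc hc] := IH (colon K a).
  - exact: colon_ideal.
  - by move=> t; apply: sub_colon.
  - by exists b => //; rewrite /colon /= mulrC.
  - by move=> t /JK; apply: sub_colon.
  have [||||c' nPc' hc'] := IH (adjoin K a).
  - exact: adjoin_ideal.
  - by move=> t; apply: sub_adjoin.
  - by exists a => //; apply: mem_adjoin.
  - by move=> t /JK; apply: sub_adjoin.
  exists (c * c'); first by move/PM => [].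
  by move=> w Ww; apply: koszul_kills_extension => //; [apply: hc|apply: hc'].
have pK : is_prime K.
  split=> // a b Kab; apply: contrapT => h; apply: no; exists a, b.
  by split=> // h'; apply: h; [left|right].
have [[c Kc nPc]|sub] := pselect (exists2 c, K c & ~ P c).
  by exists c => // w _; apply: koszul_kills_mem.
have KP : K `<=` P by move=> t Kt; apply: contrapT => nPt; apply: sub; exists t.
(* Now [K] and the associated prime (J : b) both lie between [J] and [P], so both equal [P] by
   minimality. *)
have [b pb bP] := colon_prime_inside noethR iJ pP JP.
have eK : K = colon J b.
  apply/seteqP; split=> t.
    by move=> /KP; apply: (minP _ pb) => // t' ?; apply: sub_colon.
  by move=> /bP; apply: (minP _ pK).
have [|||c nPc hc] := IHn i.+1 _ (adjoin J b).
- by lia.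
- exact: adjoin_ideal.
- by move=> t; apply: sub_adjoin.
exists (1 * c); first by rewrite mul1r.
move=> w Ww; rewrite eK; apply: koszul_kills_colon => //.
  exact: (hW w Ww).2.
exact: hc.
Qed.

End RegularSequences.

(** * Depth and chains of primes over a Cohen-Macaulay local ring *)

Section CohenMacaulay.
Variables (S : comNzRingType) (M : set S) (y : seq S).
Hypotheses (noethS : noetherian S) (iM : is_ideal M) (M1 : ~ M 1)
  (maxM : forall K, is_ideal K -> ~ K 1 -> K `<=` M)
  (yM : forall u, u \in y -> M u) (regy : regular_seq [set 0] y)
  (chain_bound : forall k (C : nat -> set S), strict_chain k C ->
    (k <= size y)%N).
Implicit Types (I J K P Q : set S) (b t u : S) (x : seq S) (k : nat).

(* The vanishing of the Koszul homology of [y] above degree [k] means that    *)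
(* [S / J] has depth at least [size y - k].                                   *)
Definition codepth_le J k : Prop :=
  forall i, (k <= i)%N -> koszul_kills y J i.+1 1.

(* Satisfied by the ideals generated by a regular sequence of length [k].     *)
Definition perfect J k : Prop :=
  [/\ is_ideal J, codepth_le J k &
      forall Q, is_prime Q -> J `<=` Q ->
        exists2 C, strict_chain k C & C k = Q].

Lemma perfect0 : perfect [set 0] 0.
Proof.
have i0 := is_ideal_set0 S; split=> //.
  move=> i _; apply: (koszul_kills_regular_powers (x := y)) => //.
  by elim: (y) => //= u w IH; split=> //; exists 0%N; rewrite expr1.
by move=> Q pQ _; exists (fun=> Q).
Qed.

Lemma codepth_adjoin J k u : is_ideal J -> regular_mod J u ->
  codepth_le J k -> codepth_le (adjoin J u) k.+1.
Proof.
move=> iJ reg cJ [//|i] ki; rewrite -[1]mulr1.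
apply: koszul_kills_adjoin => //; first by apply: cJ; apply: leqW.
by rewrite regular_colon //; apply: cJ.
Qed.

(** An associated prime of [J] inside [Q] omits the regular element [u], so the chain ending there
    can be prolonged by [Q]. *)
Lemma perfect_adjoin J k u : perfect J k -> regular_mod J u ->
  perfect (adjoin J u) k.+1.
Proof.
move=> [iJ cJ hJ] reg; split; [exact: adjoin_ideal|exact: codepth_adjoin|].
move=> Q pQ JQ.
have [|b pb bQ] := colon_prime_inside noethS iJ pQ.
  by move=> t Jt; apply/JQ/sub_adjoin.
have [|C sC eC] := hJ _ pb; first by move=> t; apply: sub_colon.
exists (fun i => if (i <= k)%N then C i else Q); last by rewrite ltnn.
apply: strict_chain_rcons => //; rewrite eC //.
exists u; first by apply/JQ/mem_adjoin.
exact: regular_mod_colon_prime.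
Qed.

(** Let [U] consist of the [t] with (J : b) t inside [J]. A member of [U] outside J + (u) has a
    multiple with the required annihilator. If there is none, members of [U] can be divided by [u]
    modulo [J] within [U], so [b] lies in every J + (u^N), hence in [J]. *)
Lemma colon_prime_adjoin J u b : is_ideal J -> M u -> regular_mod J u ->
  is_prime (colon J b) ->
  exists b', [/\ is_prime (colon (adjoin J u) b'),
                 colon J b `<=` colon (adjoin J u) b' &
                 colon (adjoin J u) b' u].
Proof.
move=> iJ Mu reg pb; have iA := adjoin_ideal u iJ.
pose U t := forall q, colon J b q -> J (q * t).
have [[t Ut nAt]|no] := pselect (exists2 t, U t & ~ adjoin J u t).
  have [s ps] := colon_prime_multiple noethS iA nAt.
  exists (t * s); split=> //.
    move=> q /Ut Jqt; apply: sub_adjoin; rewrite mulrA.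
    exact: ideal_mulr.
  by apply: ideal_mulr => //; apply: mem_adjoin.
have pow N : exists2 t, U t & J (b - u ^+ N * t).
  elim: N => [|N [t Ut Jt]].
    by exists b => //; rewrite expr0 mul1r subrr; apply: ideal_0.
  have [r hr] : adjoin J u t by apply: contrapT => nA; apply: no; exists t.
  exists r.
    move=> q Cq; apply: reg.
    have := ideal_sub iJ (Ut q Cq) (ideal_mull q iJ hr).
    by congr (J _); ring.
  have := ideal_add iJ Jt (ideal_mull (u ^+ N) iJ hr).
  by congr (J _); rewrite exprS; ring.
case: pb => _ C1 _; case: C1; rewrite /colon /= mul1r.
apply: (krull_intersection noethS iM M1 maxM (s := [:: u])) => //.
  by move=> z; rewrite inE => /eqP->.
move=> N K iK JK hK; have [t _ /JK] := pow N; apply: ideal_subr => //.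
by apply: ideal_mulr => //; apply: hK; rewrite inE.
Qed.

(** The depth of S/J is at most the dimension of S/P for an associated prime P = (J : b); that
    dimension enters through the number of elements [v] needed to reach [M] from P. *)
Lemma depth_le (v : seq S) J k b : is_ideal J -> codepth_le J k ->
  is_prime (colon J b) -> (forall u, u \in v -> M u) ->
  (forall K, is_prime K -> colon J b `<=` K -> (forall u, u \in v -> K u) ->
     M `<=` K) ->
  (size y <= k + size v)%N.
Proof.
elim: v J k b => [|v1 v IH] J k b iJ cJ pb vM rad /=.
  rewrite addn0 leqNgt; apply/negP => ky.
  (* Here [y] annihilates [b] modulo [J], so the top Koszul homology of [y] on S/J is nonzero. *)
  have sub : M `<=` colon J b by apply: rad.
  have [_ C1 _] := pb; apply: C1; rewrite /colon /= mul1r.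
  apply: (koszul_kills_top (w := y)) => //; last by move=> u /yM/sub.
  by move: ky; case: (size y) => // n ky; apply: cJ.
have vM' u : u \in v -> M u by move=> uv; apply: vM; rewrite in_cons uv orbT.
(* An associated prime containing P and [v1] replaces P. If there is none, some v1 + a with [a] in P
   is regular on S/J, and J + (v1 + a) has an associated prime containing P, hence [v1]. *)
have [[b' [pb' bb' hv1]]|no] := pselect (exists b', [/\ is_prime (colon J b'),
    colon J b `<=` colon J b' & colon J b' v1]).
  apply: leq_trans (IH J k b' iJ cJ pb' vM' _) _; last by rewrite leq_add2l.
  move=> K pK subK vK; apply: rad => // [t /bb'/subK//|u].
  by rewrite in_cons => /orP[/eqP->|/vK//]; apply: subK.
have [||a Ca reg] := @regular_mod_exists _ noethS J (colon J b) v1 iJ.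
- exact: colon_ideal.
- by move=> b' pb' [h1 h2]; apply: no; exists b'.
have Ma : M a by case: (pb) => iC C1 _; apply: (maxM iC C1).
have Mu : M (v1 + a) by apply: ideal_add => //; apply: vM; rewrite mem_head.
have [b' [pb' bb' hu]] := colon_prime_adjoin iJ Mu reg pb.
rewrite addnS -addSn.
apply: (IH (adjoin J (v1 + a)) _ b') => //.
- exact: adjoin_ideal.
- exact: codepth_adjoin.
move=> K pK subK vK; apply: rad => // [t /bb'/subK//|u].
rewrite in_cons => /orP[/eqP->|/vK//].
rewrite -(addrK a v1); apply: ideal_sub; first exact: prime_ideal.
  exact: subK.
by apply/subK/bb'.
Qed.

(** If no element of u + I were regular on S/J, an associated prime of [J] would contain [I] and
    [u], and [depth_le] with the remaining elements of [x] would contradict the equation for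
    [size y]. *)
Lemma regular_lift I x J k : is_ideal I -> I `<=` M -> perfect J k ->
  (k + size x = size y)%N -> (forall u, u \in x -> M u) ->
  (forall K, is_prime K -> I `<=` K -> J `<=` K -> (forall u, u \in x -> K u) ->
     M `<=` K) ->
  exists2 x', all2P (fun u u' => I (u' - u)) x x' & regular_seq J x'.
Proof.
move=> iI IM; elim: x J k => [|u x IH] J k pJ kx xM rad; first by exists [::].
have [iJ cJ _] := pJ.
have xM' v : v \in x -> M v by move=> vx; apply: xM; rewrite in_cons vx orbT.
have [b pb [Cu Csub]|a Ia reg] := @regular_mod_exists _ noethS J I u iJ iI.
  suff : (size y <= k + size x)%N by rewrite -kx /= leq_add2l ltnn.
  apply: (depth_le iJ cJ pb xM') => K pK subK xK;
    apply: rad => // [t /Csub/subK//|t Jt|v].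
    by apply: subK; apply: sub_colon.
  by rewrite in_cons => /orP[/eqP->|/xK//]; apply: subK.
have [||||x' hx' rx'] := IH (adjoin J (u + a)) k.+1.
- exact: perfect_adjoin.
- by rewrite -kx addSnnS.
- by [].
- move=> K pK IK AK xK; apply: rad => // [t Jt|v].
    by apply/AK/sub_adjoin.
  rewrite in_cons => /orP[/eqP->|/xK//].
  rewrite -(addrK a u); apply: ideal_sub; first exact: prime_ideal.
    exact/AK/mem_adjoin.
  exact: IK.
exists (u + a :: x') => //=; split=> //.
by rewrite addrC addKr.
Qed.

(** The chain [C] above [P] is what equidimensionality provides. Its length forces k + size x = size
    y for the largest [k], and makes [P] minimal over [J]. *)
Lemma koszul_killer_quotient I P x C : is_ideal I -> is_prime P -> I `<=` P ->
  I `<=` M -> strict_chain (size x) C -> P `<=` C 0%N ->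
  (forall u, u \in x -> M u) ->
  (forall K, is_prime K -> I `<=` K -> (forall u, u \in x -> K u) ->
    M `<=` K) ->
  exists2 x', all2P (fun u u' => I (u' - u)) x x' &
  exists2 c, ~ P c &
    forall w, all2P (@is_power S) x' w -> koszul_kills w I 1 c.
Proof.
move=> iI pP IP IM sC PC xM rad.
have pC0 : is_prime (C 0%N) by apply: sC.1.
pose F k := `[< exists2 J, J `<=` I & perfect J k >].
have bound J k Q : perfect J k -> is_prime Q -> J `<=` Q -> (k <= size y)%N.
  by move=> [_ _ h] pQ /(h Q pQ)[C' /chain_bound].
have exF : exists k, F k.
  exists 0%N; apply/asboolP; exists [set 0]; last exact: perfect0.
  by move=> t ->; apply: ideal_0.
have ubF k : F k -> (k <= size y)%N.
  move=> /asboolP[J JI pJ]; apply: (bound J k P) => //.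
  by move=> t /JI/IP.
(* A largest [J] inside [I] of this kind: then [I] lies in an associated      *)
(* prime of [J], which bounds the depth of [S / J] by [size x].               *)
case: (ex_maxnP exF ubF) => k /asboolP[J JI pJ] maxk.
have [iJ cJ hJ] := pJ.
have [b pb IQ] : exists2 b, is_prime (colon J b) & I `<=` colon J b.
  apply: contrapT => no.
  have [b pb [_ sub]|a Ia] := @regular_mod_exists _ noethS J I 0 iJ iI.
    by apply: no; exists b.
  rewrite add0r => reg; suff : (k < k)%N by rewrite ltnn.
  apply: maxk; apply/asboolP; exists (adjoin J a); last exact: perfect_adjoin.
  exact: adjoin_sub.
have lb : (size y <= k + size x)%N.
  apply: (depth_le iJ cJ pb xM) => K pK subK xK; apply: rad => //.
  by move=> t /IQ/subK.
have [C0 sC0 eC0] : exists2 C', strict_chain k C' & C' k = C 0%N.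
  by apply: hJ => // t /JI/IP/PC.
have ub := chain_bound (strict_chain_cat sC0 sC eC0).
have dim : (k + size x = size y)%N by apply/eqP; rewrite eqn_leq ub lb.
(* A prime over [J] strictly inside [P] would give a chain of length k + 1 + size x, exceeding
   [size y]. *)
have minP Q : is_prime Q -> J `<=` Q -> Q `<=` P -> P `<=` Q.
  move=> pQ JQ QP t Pt; apply: contrapT => nQt.
  have [C1 sC1 eC1] := hJ Q pQ JQ.
  have sC2 : strict_chain k.+1 (fun i => if (i <= k)%N then C1 i else C 0%N).
    apply: strict_chain_rcons => //; rewrite eC1.
      by move=> s /QP/PC.
    by exists t => //; apply: PC.
  have := chain_bound (strict_chain_cat sC2 sC _).
  by rewrite /= ltnn addSn dim => /(_ erefl); rewrite ltnn.
have [|x' xx' rx'] := regular_lift iI IM pJ dim xM.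
  by move=> K pK IK _; apply: rad.
exists x' => //.
have JP : J `<=` P by move=> t /JI/IP.
pose W : set (seq S) := [set w | all2P (@is_power S) x' w].
have hW w : W w -> size w = size x /\ forall i, koszul_kills w J i.+1 1.
  move=> hw; split; first by rewrite (all2P_size xx') (all2P_size hw).
  exact: koszul_kills_regular_powers hw.
have [c nPc hc] := koszul_uniform_killer 0 noethS iJ pP JP minP hW iI JI.
by exists c.
Qed.

End CohenMacaulay.

(** * Colon capturing *)

Lemma ideal_seq_morph (S R : comNzRingType) (f : {rmorphism S ->
  R}) (w : seq S) t :
  range f = setT ->
  ideal_seq [set s | f s = 0] w t <-> ideal_seq [set 0] (map f w) (f t).
Proof.
move=> surj; elim: w t => [|u w IH] t //=.
split=> [[r /IH]|[r]]; first by rewrite rmorphB rmorphM; exists (f r).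
have [s _ <-] : range f r by rewrite surj.
by rewrite -rmorphM -rmorphB => /IH; exists s.
Qed.

Lemma all2P_power_map (S R : comNzRingType) (f : {rmorphism S -> R})
    (x : seq S) (w : seq R) :
  all2P (@is_power R) (map f x) w ->
  exists2 w', all2P (@is_power S) x w' & map f w' = w.
Proof.
elim: x w => [|u x IH] [|v w] //=; first by exists [::].
move=> [[n ->] /IH[w' xw' <-]]; exists (u ^+ n.+1 :: w');
  last by rewrite /= rmorphXn.
by split=> //; exists n.
Qed.

Section ColonCapturing.
Variables (R : comNzRingType) (m : idealr R) (d : nat).
Hypotheses (noethR : noetherian R) (locR : local_ring m)
  (dimR : has_krull_dim R d) (equiR : equidimensional R).

Definition colon_killer (u : R) (w : seq R) : set R :=
  [set c | forall n w' r, all2P (@is_power R) w w' ->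
     ideal_seq [set 0] w' (u ^+ n.+1 * r) -> ideal_seq [set 0] w' (c * r)].

Lemma colon_killer_ideal u w : is_ideal (colon_killer u w).
Proof.
have iw w' := ideal_seq_ideal w' (is_ideal_set0 R).
split.
- by move=> n w' r _ _; rewrite mul0r; apply: ideal_0.
- move=> a b ha hb n w' r ww' h; rewrite mulrDl; apply: ideal_add => //.
    exact: ha ww' h.
  exact: hb ww' h.
- move=> c a ha n w' r ww' h; rewrite -mulrA; apply: ideal_mull => //.
  exact: ha ww' h.
Qed.

Lemma colon_killer_prime (u : R) (w : seq R) (P : prime_idealr R) :
  image_of_cohen_macaulay_local R -> minimal_prime P ->
  size (u :: w) = d -> (forall v, v \in u :: w -> v \in m) ->
  (forall K : set R, is_prime K -> (forall v, v \in u :: w -> K v) ->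
     [set` m] `<=` K) ->
  exists2 c, colon_killer u w c & c \notin P.
Proof.
move=> [S [[noethS [mS [locS [D [_ dimS] [[y ry sy] _]]]]] [f surj]]] minP sw
  wm rad.
have maxm := local_ringP noethR locR; have maxM := local_ringP noethS locS.
have iM := idealr_is_ideal mS.
have M1 : ~ [set` mS] 1 by rewrite /= idealr1.
have m1 : ~ [set` m] 1 by rewrite /= idealr1.
pose I : set S := [set s | f s = 0].
pose PS : set S := [set s | f s \in P].
have iI : is_ideal I.
  split=> [|a b|r a]; rewrite /I /= ?rmorph0 // ?rmorphD ?rmorphM.
    by move=> -> ->; rewrite addr0.
  by move=> ->; rewrite mulr0.
have [iP P1 PM] := prime_idealr_is_prime P.
have pPS : is_prime PS.
  split; first split.
  - by rewrite /PS /= rmorph0; apply: (ideal_0 iP).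
  - by move=> a b; rewrite /PS /= rmorphD; apply: (ideal_add iP).
  - by move=> r a; rewrite /PS /= rmorphM; apply: (ideal_mull _ iP).
  - by rewrite /PS /= rmorph1.
  - by move=> a b; rewrite /PS /= rmorphM; apply: PM.
have IP : I `<=` PS by move=> t; rewrite /I /PS /= => ->; apply: (ideal_0 iP).
have IM : I `<=` [set` mS].
  by apply: maxM => //; rewrite /I /= rmorph1 => /eqP; rewrite oner_eq0.
have sec r : exists s, f s = r.
  by have [s _ <-] : range f r by [rewrite surj]; exists s.
have [g fg] := choice sec.
have Mm t : t \in mS -> f t \in m.
  move=> Mt; apply: contrapT => nm.
  have [r hr] := local_unit maxm nm.
  have : I (g r * t - 1) by rewrite /I /= rmorphB rmorphM rmorph1 fg hr subrr.
  move=> /IM h; apply: M1; rewrite -(subKr (g r * t) 1).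
  by apply: (ideal_sub iM) => //; apply: (ideal_mull _ iM).
have mM t : f t \in m -> t \in mS.
  move=> mt; apply: (maxM [set s | f s \in m]) => //=; last by rewrite rmorph1.
  have im := idealr_is_ideal m; split=> /=.
  - by rewrite rmorph0; apply: (ideal_0 im).
  - by move=> a b; rewrite rmorphD; apply: (ideal_add im).
  - by move=> r a; rewrite rmorphM; apply: (ideal_mull _ im).
pose x := map g (u :: w).
have fx : map f x = u :: w.
  by rewrite -map_comp -[RHS]map_id; apply: eq_map => v /=.
(* By equidimensionality R/P has a chain of primes of length [d]; it is pulled back to [S]. *)
have [[Pq chq] _] := (equiR minP d).2 dimR.
pose pi : R -> {ideal_quot P} := \pi_{ideal_quot P}%qT.
pose C i : set S := [set t | pi (f t) \in Pq (inord i)].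
have sC : strict_chain (size x) C.
  rewrite size_map sw; split=> i ld.
    have [iQ Q1 QM] := prime_idealr_is_prime (Pq (inord i)).
    split; first split.
    - by rewrite /C /pi /= rmorph0 rmorph0; apply: (ideal_0 iQ).
    - by move=> a b; rewrite /C /pi /= rmorphD rmorphD; apply: (ideal_add iQ).
    - by move=> r a; rewrite /C /pi /= rmorphM rmorphM;
        apply: (ideal_mull _ iQ).
    - by rewrite /C /pi /= rmorph1 rmorph1.
    - by move=> a b; rewrite /C /pi /= rmorphM rmorphM; apply: QM.
  have [|sub nsub] := chq (inord i) (inord i.+1).
    by rewrite !inordK // ltnS // ltnW.
  split; first by move=> t; apply: sub.
  have /existsNP[q /not_implyP[Qq nQq]] := nsub.
  exists (g (repr q)); rewrite /C /= fg /pi reprK //.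
have PC : PS `<=` C 0%N.
  move=> t; rewrite /PS /C /= => Pt.
  have -> : pi (f t) = 0.
    by rewrite -(rmorph0 pi); apply/eqP; rewrite -Quotient.idealrBE subr0.
  exact: idealr0.
have xM v : v \in x -> [set` mS] v.
  by move=> vx; apply: mM; apply: wm; rewrite -fx map_f.
have radS K : is_prime K -> I `<=` K -> (forall v, v \in x -> K v) ->
    [set` mS] `<=` K.
  move=> [iK K1 KM] IK xK.
  have fK t : (exists2 s, K s & f s = f t) -> K t.
    move=> [s Ks fst]; apply: (ideal_subr (b := s)) => //; apply: IK.
    by rewrite /I /= rmorphB fst subrr.
  have pK' : is_prime [set r | exists2 s, K s & f s = r].
    split; first split.
    - by exists 0; [apply: ideal_0|rewrite rmorph0].
    - move=> _ _ [s Ks <-] [t Kt <-]; exists (s + t); last by rewrite rmorphD.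
      exact: ideal_add.
    - move=> r _ [s Ks <-]; exists (g r * s); last by rewrite rmorphM fg.
      exact: ideal_mull.
    - by rewrite /= -(rmorph1 f) => /fK.
    - move=> a b /=; rewrite -{1}(fg a) -{1}(fg b) -rmorphM => /fK/KM.
      by case=> h; [left|right]; [exists (g a)|exists (g b)].
  move=> t /Mm ft; apply: fK; apply: (rad _ pK') => //.
  move=> v; rewrite -fx => /mapP[s sx ->]; exists s => //.
  exact: xK.
have yM v : v \in y -> [set` mS] v by apply: ry.1.
have chb k (C' : nat -> set S) : strict_chain k C' -> (k <= size y)%N.
  by rewrite sy => /strict_chain_prime_chain[Q /dimS].
have [x' xx' [c nPc hc]] := koszul_killer_quotient noethS iM M1 maxM yM
  (regular_sequence_seq ry) chb iI pPS IP IM sC PC xM radS.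
have fx' : map f x' = u :: w.
  rewrite -fx; elim: (x) x' xx' {hc} => [|a z IH] [|b z'] //= [Iab /IH->].
  by congr (_ :: _); apply/eqP; rewrite -subr_eq0 -rmorphB; apply/eqP.
exists (f c); last exact/negP.
case: x' fx' hc {xx'} => [//|u' z] /= [fu fz] hc n w' r.
rewrite -fz => /all2P_power_map[z' zz' <-].
rewrite -fu -(fg r) -rmorphXn -!rmorphM => /(ideal_seq_morph _ _ surj) h.
apply/(ideal_seq_morph _ _ surj).
apply: koszul_kills_colon1 h => //; apply: hc; split=> //.
by exists n.
Qed.

(** The killers form an ideal contained in no minimal prime. Minimal primes are associated to 0, so
    they are finite in number and can be avoided simultaneously. *)
Lemma colon_killer_exists (u : R) (w : seq R) :
  image_of_cohen_macaulay_local R ->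
  size (u :: w) = d -> (forall v, v \in u :: w -> v \in m) ->
  (forall K : set R, is_prime K -> (forall v, v \in u :: w -> K v) ->
     [set` m] `<=` K) ->
  exists2 c, colon_killer u w c &
    forall P : prime_idealr R, minimal_prime P -> c \notin P.
Proof.
move=> imR sw wm rad.
have i0 := is_ideal_set0 R.
have [s hs] := colon_primes_finite noethR i0.
pose F Q := `[< exists2 P : prime_idealr R, minimal_prime P & Q = [set` P] >].
have [Q|c kc hc] := coset_avoidance (s := [seq Q <- s | F Q]) (v := 0)
    (colon_killer_ideal u w).
  rewrite mem_filter => /andP[/asboolP[P minP ->] _].
  split; first exact: prime_idealr_is_prime.
  have [c kc /negP nPc] := colon_killer_prime imR minP sw wm rad.
  by move=> [_ /(_ c kc)].
exists c => // P minP; apply/negP => Pc.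
apply: (hc [set` P]); last by rewrite add0r.
rewrite mem_filter; apply/andP; split; first by apply/asboolP; exists P.
have pP := prime_idealr_is_prime P.
have [|b pb bP] := colon_prime_inside noethR i0 pP.
  by move=> t ->; apply: (ideal_0 (prime_ideal pP)).
have [P' hP'] := prime_idealr_of pb.
have PP' : {subset P <= P'}.
  by apply: minP => t; rewrite hP' => /asboolP; apply: bP.
rewrite (_ : [set` P] = colon [set 0] b); first exact: hs.
apply/seteqP; split=> t; last exact: bP.
by move=> /PP'; rewrite hP' => /asboolP.
Qed.

End ColonCapturing.

(** * Intersections of monomial ideals *)

Section MonomialIntersections.
Variables (R : comNzRingType) (s : nat).
Implicit Types (X : 'I_s -> R) (b : 'I_s -> nat) (c t u : R) (j : 'I_s).

Definition skip_ideal X b j : set R :=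
  ideal_gen [set X i ^+ (b i).+1 | i in [set i | i != j]].

Definition tail_ideal X (k : nat) : set R :=
  ideal_gen [set X i | i in [set i : 'I_s | (k < i)%N]].

(* The exponents in [Lambda s n] are at least 1, whence the shift by 1.       *)
Definition shifted_ideal X b : set R := power_ideal X (fun i => (b i).+1).

Lemma mem_shifted X b j : shifted_ideal X b (X j ^+ (b j).+1).
Proof. by apply: mem_ideal_gen; exists j. Qed.

Lemma skip_sub_shifted X b b' j : (forall i, i != j -> b i = b' i) ->
  skip_ideal X b j `<=` shifted_ideal X b'.
Proof.
move=> bb'; apply: ideal_gen_sub; first exact: ideal_gen_ideal.
by move=> _ [i ij <-]; rewrite bb' //; apply: mem_shifted.
Qed.

Lemma shifted_split X b j t : shifted_ideal X b t ->
  exists r, skip_ideal X b j (t - r * X j ^+ (b j).+1).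
Proof.
have iS : is_ideal (skip_ideal X b j) := ideal_gen_ideal _.
suff sub : shifted_ideal X b `<=` adjoin (skip_ideal X b j) (X j ^+ (b j).+1).
  by move/sub.
apply: ideal_gen_sub; first exact: adjoin_ideal.
move=> _ [i _ <-]; have [->|ij] := eqVneq i j; first exact: mem_adjoin.
by apply: sub_adjoin; apply: mem_ideal_gen; exists i.
Qed.

Lemma ideal_pow_ideal (I : set R) n : is_ideal (ideal_pow I n).
Proof. by case: n => [|n]; [split|apply: ideal_gen_ideal]. Qed.

Lemma ideal_powS (I : set R) n a t : I a -> ideal_pow I n t ->
  ideal_pow I n.+1 (a * t).
Proof. by move=> Ia It; apply: mem_ideal_gen; exists a => //; exists t. Qed.

Lemma ideal_pow_exp (I : set R) n a : I a -> ideal_pow I n (a ^+ n).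
Proof.
by move=> Ia; elim: n => // n IH; rewrite exprS; apply: ideal_powS.
Qed.

(** A monomial of degree n exceeding the sum of the b_i is divisible by some X_i^(b_i+1). In the
    induction, a factor X_i is paid for by lowering b_i by one. *)
Lemma ideal_pow_shifted X n b : (\sum_i b i < n)%N ->
  ideal_pow (ideal_gen (range X)) n `<=` shifted_ideal X b.
Proof.
elim: n b => // n IH b bn;
  have iX : is_ideal (shifted_ideal X b) := ideal_gen_ideal _.
apply: ideal_gen_sub => // _ [a Qa [t Pt <-]].
suff sub : ideal_gen (range X) `<=` colon (shifted_ideal X b) t by apply: sub.
apply: ideal_gen_sub; first exact: colon_ideal.
move=> _ [i _ <-]; rewrite /colon /=.
case bi : (b i) => [|k].
  by have := @mem_shifted X b i; rewrite bi expr1; apply: (ideal_mulr t iX).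
pose b' j := if j == i then k else b j.
have [|r hr] := @shifted_split X b' i t.
  apply: IH Pt; move: bn;
    rewrite (bigD1 i) //= [in X in _ -> X](bigD1 i) //= bi.
  rewrite /b' eqxx addSn ltnS; apply: leq_trans; rewrite ltnS leq_add2l.
  by apply: leq_sum => j /negbTE ->.
rewrite -(subrK (r * X i ^+ (b' i).+1) t) mulrDr.
apply: (ideal_add iX).
  apply: (ideal_mull _ iX); apply: skip_sub_shifted hr => j ji.
  by rewrite /b' (negbTE ji).
rewrite /b' eqxx mulrCA -exprS -bi; apply: (ideal_mull _ iX).
exact: mem_shifted.
Qed.

(* Setting [X k.+1] to zero gives the case [k]; dividing the remainder by     *)
(* [X k.+1], at the cost of a factor [c], gives the case [m].  The exponent   *)
(* [N] may not depend on [X], which is going to range over Frobenius powers.  *)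
Lemma monomial_intersection (k m : nat) : (k < s)%N -> exists N, forall X c,
  (forall j b t, skip_ideal X b j (X j * t) -> skip_ideal X b j (c * t)) ->
  forall u, (forall b, (forall i : 'I_s, (k < i)%N -> b i = 0%N) ->
               (\sum_i b i = m)%N -> shifted_ideal X b u) ->
  exists2 l, tail_ideal X k l &
             ideal_pow (ideal_gen (range X)) m.+1 (c ^+ N * u - l).
Proof.
elim: k m => [|k IHk] m ks.
  (* For this tuple the ideal is generated by X_0^(m+1) and the tail. *)
  exists 0%N => X c _ u /(_ (fun i => if i == Ordinal ks then m else 0%N)) h.
  have [||r hr] := @shifted_split X _ (Ordinal ks) u (h _ _).
  - by move=> i; case: eqP => // ->.
  - rewrite (bigD1 (Ordinal ks)) //= ?eqxx big1 ?addn0 // => i.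
    by move/negbTE ->.
  rewrite /= ?eqxx in hr; exists (u - r * X (Ordinal ks) ^+ m.+1).
    move: hr; apply: ideal_gen_sub; first exact: ideal_gen_ideal.
    move=> _ [i /= ni <-]; rewrite (negbTE ni) expr1.
    apply: mem_ideal_gen; exists i => //=; rewrite lt0n.
    by apply: contraNneq ni => i0; apply/eqP/val_inj.
  rewrite expr0 mul1r subKr; apply: (ideal_mull _ (ideal_pow_ideal _ _)).
  by apply: ideal_pow_exp; apply: mem_ideal_gen; exists (Ordinal ks).
pose j := Ordinal ks.
elim: m => [|m [N2 IHm]].
  exists 0%N => X c _ u /(_ (fun=> 0%N)) h; exists 0.
    exact: (ideal_0 (ideal_gen_ideal _)).
  rewrite subr0 expr0 mul1r -[u]mulr1; apply: ideal_powS => //.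
  have : shifted_ideal X (fun=> 0%N) u by apply: h => //; rewrite big1.
  apply: ideal_gen_sub; first exact: ideal_gen_ideal.
  by move=> _ [i _ <-]; rewrite expr1; apply: mem_ideal_gen; exists i.
have [N1 hN1] := IHk m.+1 (ltnW ks).
(* [N1] serves the reduction modulo X_j, one factor the division by X_j, and [N2] the quotient [w]
   in the case [m]. *)
exists (N2 + N1.+1)%N => X c hc u hu.
set Q := ideal_gen (range X).
have iP n : is_ideal (ideal_pow Q n) := ideal_pow_ideal Q n.
have iL n : is_ideal (tail_ideal X n) := ideal_gen_ideal _.
have [|l0 Ll0 Pv] := hN1 X c hc u.
  by move=> b hb; apply: hu => i /ltnW; apply: hb.
have [w Lw] : adjoin (tail_ideal X k.+1) (X j) l0.
  move: l0 Ll0 {Pv}; apply: ideal_gen_sub; first exact: adjoin_ideal.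
  move=> _ [i /= ki <-]; have [->|ij] := eqVneq i j; first exact: mem_adjoin.
  apply: sub_adjoin; apply: mem_ideal_gen; exists i => //=.
  rewrite ltn_neqAle ki andbT eq_sym; apply: contraNneq ij => e.
  by apply/eqP/val_inj.
set l := l0 - w * X j in Lw; set v := _ - l0 in Pv.
have eu : c ^+ N1 * u = v + (l + X j * w) by rewrite /v /l; ring.
have [|l2 Ll2 Pv2] := IHm X c hc (c * w).
  move=> b hb sb; pose b' i := (b i + (i == j))%N.
  have sb' : (\sum_i b' i = m.+1)%N.
    rewrite big_split /= sb (bigD1 j) //= ?eqxx big1 ?addn0 ?addn1 // => i.
    by move/negbTE ->.
  have hb' (i : 'I_s) : (k.+1 < i)%N -> b' i = 0%N.
    move=> ki; rewrite /b' hb // add0n; case: eqP => // e.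
    by move: ki; rewrite e ltnn.
  have iX : is_ideal (shifted_ideal X b') := ideal_gen_ideal _.
  (* Here [v] has degree m + 2, above the sum m + 1 of [b'], and [l] involves only variables with
     exponent 1. *)
  have Xw : shifted_ideal X b' (X j * w).
    rewrite (_ : X j * w = c ^+ N1 * u - v - l); last by rewrite eu; ring.
    apply: (ideal_sub iX); first apply: (ideal_sub iX).
    - by apply: (ideal_mull _ iX); apply: hu.
    - by apply: ideal_pow_shifted Pv; rewrite sb'.
    move: l Lw {eu}; apply: ideal_gen_sub => // _ [i /= ki <-].
    by rewrite -[X i]expr1 -(hb' i ki); apply: mem_shifted.
  have [r hr] := shifted_split j Xw.
  have hr' : skip_ideal X b j (X j * (w - r * X j ^+ (b j).+1)).
    have -> : skip_ideal X b j = skip_ideal X b' j.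
      congr ideal_gen; apply/seteqP; split=> _ [i /= ij <-]; exists i => //.
        by rewrite /b' (negbTE ij) addn0.
      by rewrite /b' (negbTE ij) addn0.
    move: hr; congr (skip_ideal _ _ _ _).
    by rewrite /b' eqxx addn1 [_ ^+ (b j).+2]exprS; ring.
  have := skip_sub_shifted (b' := b) (fun _ _ => erefl) (hc _ _ _ hr').
  rewrite mulrBr.
  have iXb := ideal_gen_ideal (range (fun i => X i ^+ (b i).+1)).
  apply: (ideal_subr iXb); do 2!apply: (ideal_mull _ iXb).
  exact: mem_shifted.
exists (c ^+ N2.+1 * l + X j * l2).
  by apply: (ideal_add (iL _)); apply: (ideal_mull _ (iL _)).
have -> : c ^+ (N2 + N1.+1) * u - (c ^+ N2.+1 * l + X j * l2) =
    c ^+ N2.+1 * v + X j * (c ^+ N2 * (c * w) - l2).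
  rewrite addnS -addSn exprD -mulrA eu exprSr; ring.
apply: (ideal_add (iP m.+2)); first exact: (ideal_mull _ (iP m.+2)).
by apply: ideal_powS => //; apply: mem_ideal_gen; exists j.
Qed.

Lemma monomial_intersection_full m : (0 < s)%N -> exists N, forall X c,
  (forall j b t, skip_ideal X b j (X j * t) -> skip_ideal X b j (c * t)) ->
  forall u, (forall b, (\sum_i b i = m)%N -> shifted_ideal X b u) ->
  ideal_pow (ideal_gen (range X)) m.+1 (c ^+ N * u).
Proof.
move=> s0; have [|N hN] := @monomial_intersection s.-1 m;
  first by rewrite prednK.
exists N => X c hc u hu; have [|l Ll] := hN X c hc u; first by move=> b _;
  apply: hu.
suff -> : l = 0 by rewrite subr0.
move: l Ll; apply: ideal_gen_sub; first exact: is_ideal_set0.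
by move=> _ [i /= si <-]; have := ltn_ord i; lia.
Qed.

End MonomialIntersections.

(** * Tight closure *)

Lemma tight_closure_mono (R : comNzRingType) (p : nat) (I J : set R) :
  I `<=` J -> tight_closure p I `<=` tight_closure p J.
Proof.
move=> IJ t [c cR [e0 he]]; exists c => //; exists e0 => e /he.
apply: ideal_gen_sub; first exact: ideal_gen_ideal.
by move=> _ [a /IJ Ja <-]; apply: mem_ideal_gen; exists a.
Qed.

(** As Frobenius is additive, the elements whose p^e-th power lies in the ideal on the right form an
    ideal. *)
Lemma frobenius_power_gen (R : comNzRingType) (p e : nat) (T : Type)
    (g : T -> R) : p \in [pchar R] ->
  frobenius_power (ideal_gen (range g)) (p ^ e) `<=`
  ideal_gen (range (fun i => g i ^+ (p ^ e))).
Proof.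
move=> pR; set J := (X in _ `<=` X).
have iJ : is_ideal J := ideal_gen_ideal _.
have pe : [pchar R].-nat (p ^ e)%N.
  by rewrite pnatX pnatE ?pR // (pcharf_prime pR).
apply: ideal_gen_sub => // _ [a Ia <-].
suff sub : ideal_gen (range g) `<=` [set a | J (a ^+ (p ^ e))] by apply: sub.
apply: ideal_gen_sub; last by move=> _ [i _ <-]; apply: mem_ideal_gen; exists i.
split=> /=.
- rewrite expr0n eqn0Ngt expn_gt0 prime_gt0 ?(pcharf_prime pR) //=.
  exact: (ideal_0 iJ).
- by move=> b c; rewrite exprDn_pchar //; apply: (ideal_add iJ).
- by move=> r b; rewrite exprMn; apply: (ideal_mull _ iJ).
Qed.

Lemma ideal_pow_frobenius (R : comNzRingType) (q n : nat) (T : Type)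
    (g : T -> R) :
  ideal_pow (ideal_gen (range (fun i => g i ^+ q))) n `<=`
  frobenius_power (ideal_pow (ideal_gen (range g)) n) q.
Proof.
elim: n => [|n IH].
  by move=> t _; rewrite -[t]mulr1 -(expr1n R q);
    apply: (ideal_mull _ (ideal_gen_ideal _));
    apply: mem_ideal_gen; exists 1.
set J := frobenius_power _ _; have iJ : is_ideal J := ideal_gen_ideal _.
apply: ideal_gen_sub => // _ [a Qa [b /IH Fb <-]].
rewrite mulrC; move: b Fb {IH}.
suff sub : frobenius_power (ideal_pow (ideal_gen (range g)) n) q `<=` colon J a.
  by move=> b /sub.
apply: ideal_gen_sub; first exact: colon_ideal.
move=> _ [b Pb <-]; rewrite /colon /= mulrC.
suff sub : ideal_gen (range (fun i => g i ^+ q)) `<=` colon J (b ^+ q).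
  exact: sub.
apply: ideal_gen_sub; first exact: colon_ideal.
move=> _ [i _ <-]; rewrite /colon /= -exprMn; apply: mem_ideal_gen.
exists (g i * b) => //; apply: ideal_powS => //.
by apply: mem_ideal_gen; exists i.
Qed.

(** * Uniform colon killers for a system of parameters *)

Section SystemOfParameters.
Variables (R : comNzRingType) (m : idealr R) (d : nat).
Hypotheses (noethR : noetherian R) (locR : local_ring m)
  (dimR : has_krull_dim R d) (equiR : equidimensional R)
  (imR : image_of_cohen_macaulay_local R).
Variables (x : 'I_d -> R) (s : nat) (le_sd : (s <= d)%N).
Hypothesis (sopx : system_of_parameters m x).

Definition generic : set R :=
  [set c | forall P : prime_idealr R, minimal_prime P -> c \notin P].

Lemma genericM a b : generic a -> generic b -> generic (a * b).
Proof.
move=> ga gb P minP; rewrite prime_idealrM negb_or.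
by rewrite (ga P minP) (gb P minP).
Qed.

Lemma generic1 : generic 1.
Proof. by move=> P _; rewrite idealr1. Qed.

Lemma genericX a n : generic a -> generic (a ^+ n).
Proof.
move=> ga; elim: n => [|n IH]; first by rewrite expr0; apply: generic1.
by rewrite exprS; apply: genericM.
Qed.

Lemma generic_prod (T : finType) (c : T -> R) :
  (forall i, generic (c i)) -> generic (\prod_i c i).
Proof. by move=> gc; elim/big_ind: _ => //;
  [apply: generic1|apply: genericM]. Qed.

Lemma parameter_mem i : x i \in m.
Proof.
suff : [set` m] (x i) by [].
rewrite -sopx; exists 1%N; rewrite expr1.
by apply: mem_ideal_gen; exists i.
Qed.

Lemma parameter_prime (K : set R) : is_prime K -> (forall i, K (x i)) ->
  [set` m] `<=` K.
Proof.
move=> pK xK t; rewrite -sopx => -[n hn]; apply: (prime_pow (n := n)) => //.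
move: hn; apply: ideal_gen_sub; first exact: prime_ideal.
by move=> _ [i _ <-].
Qed.

(* The parameters that are not among the first [s] are given the exponents    *)
(* [N.+1] for all [N], and removed by Krull's intersection theorem.           *)
Lemma parameter_colon_killer_at (j : 'I_s) : exists2 c, generic c &
  forall q b t, (0 < q)%N ->
    skip_ideal (fun i => initial le_sd x i ^+ q) b j
      (initial le_sd x j ^+ q * t) ->
    skip_ideal (fun i => initial le_sd x i ^+ q) b j (c * t).
Proof.
have i0 := is_ideal_set0 R.
pose j' := widen_ord le_sd j.
pose r := [seq i <- enum 'I_d | i != j'].
have mem i : x i \in x j' :: map x r.
  have [->|ij] := eqVneq i j'; first exact: mem_head.
  by rewrite in_cons; apply/orP; right; apply: map_f;
    rewrite mem_filter ij mem_enum.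
have [|||c kc gc] := @colon_killer_exists R m d noethR locR dimR equiR (x j')
  (map x r) imR.
- rewrite /= size_map /r size_filter.
  have := count_predC (pred1 j') (enum 'I_d).
  by rewrite size_enum_ord count_uniq_mem ?enum_uniq // mem_enum inE.
- by move=> v; rewrite in_cons => /orP[/eqP->|/mapP[i _ ->]];
    apply: parameter_mem.
- move=> K pK xK; apply: parameter_prime => // i; exact: xK.
exists c => // q b t q0 hs.
set L := skip_ideal _ _ _ in hs *.
have iL : is_ideal L := ideal_gen_ideal _.
have m1 : ~ [set` m] 1 by rewrite /= idealr1.
apply: (krull_intersection noethR (idealr_is_ideal m) m1
  (local_ringP noethR locR) (s := map x (enum 'I_d))) => //.
  by move=> y /mapP[i _ ->]; apply: parameter_mem.
move=> N K iK LK hK.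
pose ex (i : 'I_d) := if insub (val i) is Some i' then (q *
  (b i').+1)%N else N.+1.
have ex0 i : (0 < ex i)%N by rewrite /ex; case: insub => // i';
  rewrite muln_gt0 q0.
have exw (i : 'I_s) : ex (widen_ord le_sd i) = (q * (b i).+1)%N.
  by rewrite /ex /= valK.
have pw : all2P (@is_power R) (map x r) (map (fun i => x i ^+ ex i) r).
  elim: r {mem kc} => //= i r IH; split=> //; exists (ex i).-1.
  by rewrite prednK.
apply: (ideal_seq_sub (J := [set 0]) (w := map (fun i => x i ^+ ex i) r)) => //.
- by move=> y ->; apply: ideal_0.
- move=> y /mapP[i]; rewrite mem_filter => /andP[ij _] ->; rewrite /ex.
  case: insubP => [i' _ ei|_].
    apply: LK; apply: mem_ideal_gen; exists i'.
      by apply: contraNneq ij => e; rewrite -val_eqE /= -e ei.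
    by rewrite -exprM; congr (x _ ^+ _); apply/val_inj.
  by rewrite exprS; apply: ideal_mull => //; apply: hK;
    rewrite map_f // mem_enum.
have := kc q.-1 _ t pw; rewrite prednK //; apply.
move: hs; apply: ideal_gen_sub; first exact: ideal_seq_ideal.
move=> _ [i /= ij <-]; rewrite -exprM -exw; apply: mem_ideal_seq => //.
apply: (map_f (fun i => x i ^+ ex i)); rewrite mem_filter mem_enum andbT.
by apply: contraNneq ij => /(congr1 val)/= e; apply/eqP/val_inj.
Qed.

Lemma parameter_colon_killer : exists2 c, generic c &
  forall q (j : 'I_s) b t, (0 < q)%N ->
    skip_ideal (fun i => initial le_sd x i ^+ q) b j
      (initial le_sd x j ^+ q * t) ->
    skip_ideal (fun i => initial le_sd x i ^+ q) b j (c * t).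
Proof.
have h j : exists c, generic c /\ forall q b t, (0 < q)%N ->
    skip_ideal (fun i => initial le_sd x i ^+ q) b j
      (initial le_sd x j ^+ q * t) ->
    skip_ideal (fun i => initial le_sd x i ^+ q) b j (c * t).
  by have [c gc hc] := parameter_colon_killer_at j; exists c.
have [c hc] := choice h.
exists (\prod_j c j); first by apply: generic_prod => j; apply: (hc j).1.
move=> q j b t q0 /((hc j).2 q b t q0) ht.
by rewrite (bigD1 j) //= mulrAC; apply: (ideal_mulr _ (ideal_gen_ideal _)).
Qed.

End SystemOfParameters.

Theorem corollary1p3 (R : comNzRingType) (m : idealr R) (d p : nat)
  (noethR : noetherian R) (locR : local_ring m)
  (dimR : has_krull_dim R d) (equiR : equidimensional R)
  (charR : p \in [pchar R]) (imR : image_of_cohen_macaulay_local R)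
  (x : 'I_d -> R) (sopx : system_of_parameters m x)
  (s n : nat) (s_ge1 : (1 <= s)%N) (le_sd : (s <= d)%N) (n_ge1 : (1 <= n)%N) :
  \bigcap_(alpha in Lambda s n)
     tight_closure p (power_ideal (initial le_sd x) alpha) =
  tight_closure p (ideal_pow (ideal_gen (range (initial le_sd x))) n).
Proof.
set X := initial le_sd x.
have shift b : (\sum_(i < s) (b i).+1 = \sum_(i < s) b i + s)%N.
  under eq_bigr do rewrite -addn1.
  by rewrite big_split /= sum1_card card_ord.
apply/seteqP; split=> u; last first.
  move=> hu a [a1 sa]; move: u hu; apply: tight_closure_mono.
  (* The shifted exponents add up to n - 1, which is less than [n]. *)
  have -> : a = fun i => (a i).-1.+1 by apply/funext => i; rewrite prednK.
  apply: ideal_pow_shifted.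
  have := shift (fun i => (a i).-1).
  rewrite (eq_bigr a) => [|i _]; last by rewrite prednK.
  rewrite sa; move: (\sum_i _)%N => z; lia.
move=> hu.
(* Tuples in [Lambda s n] have entries at most [n], so finitely many [g] represent them all. Any
   other [g] gets the values 1 and 0, harmless in the product and the maximum below. *)
have h (g : {ffun 'I_s -> 'I_(s + n)}) : exists ce : R * nat, generic ce.1 /\
    (Lambda s n (fun i => g i : nat) -> forall e, (ce.2 <= e)%N ->
      frobenius_power (power_ideal X (fun i => g i : nat)) (p ^ e)
        (ce.1 * u ^+ (p ^ e))).
  have [L|nL] := pselect (Lambda s n (fun i => g i : nat)).
    by have [c gc [e0 he]] := hu _ L; exists (c, e0).
  by exists (1, 0%N); split=> //; apply: generic1.
have [ce hce] := choice h.
pose c' := \prod_g (ce g).1; pose e0 := (\max_g (ce g).2)%N.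
have [c gc kc] := parameter_colon_killer noethR locR dimR equiR imR le_sd sopx.
have [N hN] := monomial_intersection_full R n.-1 s_ge1.
exists (c ^+ N * c').
  apply: genericM; first exact: genericX.
  by apply: generic_prod => g; apply: (hce g).1.
exists e0 => e ee.
(* With q = p^e, [hN] is applied to the family X_i^q and the element c' u^q; [N] and [c] do not
   depend on [e]. *)
apply: ideal_pow_frobenius; rewrite -[n in ideal_pow _ n]prednK // -mulrA.
have q0 : (0 < p ^ e)%N by rewrite expn_gt0 prime_gt0 // (pcharf_prime charR).
apply: hN => [j b t|b sb]; first exact: kc.
have bs i : ((b i).+1 < s + n)%N.
  have : (b i <= \sum_i b i)%N by rewrite (bigD1 i) //= leq_addr.
  by rewrite sb; lia.
pose g := [ffun i => Ordinal (bs i)].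
have eg : (fun i => g i : nat) = (fun i => (b i).+1).
  by apply/funext => i; rewrite ffunE.
have Lg : Lambda s n (fun i => g i : nat).
  rewrite eg; split=> //; rewrite shift sb; lia.
have := (hce g).2 Lg e (leq_trans (leq_bigmax g) ee).
rewrite eg => /(frobenius_power_gen charR) hg.
rewrite /c' (bigD1 g) //= mulrAC.
apply: (ideal_mulr _ (ideal_gen_ideal _)); move: hg; congr (ideal_gen _ _).
by apply: eq_imagel => i _; rewrite exprAC.
Qed.
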